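(* Let $\mathbb{G}$ be a second countable compact group, and consider the Cayley graphon $w:\mathbb{G}\times\mathbb{G}\to[0,1]$, $w(x,y)=\gamma(xy^{-1})$, obtained from a Cayley function $\gamma:\mathbb{G}\to[0,1]$. For each $\pi\in\widehat{\mathbb{G}}$, let $\mathcal{E}_{\overline{\pi(\gamma)}}$ denote a fixed eigenbasis for $\overline{\pi(\gamma)}$, where the matrix $\overline{\pi(\gamma)}$ is obtained from $\pi(\gamma)$ by taking complex conjugation entry-wise. Then $$\bigcup_{\pi\in\widehat{\mathbb{G}}}\ \bigcup_{i=1}^{d_\pi}\left\{\sum_{j=1}^{d_\pi}z_j\pi_{i,j}\ :\ \begin{bmatrix}z_1\\ \vdots\\ z_{d_\pi}\end{bmatrix}\in\mathcal{E}_{\overline{\pi(\gamma)}}\right\}$$ is an (orthogonal) eigenbasis for $T_w$.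
   Context: Compact groups are compact Hausdorff topological groups, equipped with their normalized (probability) Haar measure $dx$. A Cayley function is a measurable function $\gamma:\mathbb{G}\to[0,1]$ with $\gamma(x)=\gamma(x^{-1})$ for all $x\in\mathbb{G}$. $T_w:L^2(\mathbb{G})\to L^2(\mathbb{G})$ is the integral operator $T_w(f)(x)=\int_{\mathbb{G}}w(x,y)f(y)\,dy$. $\widehat{\mathbb{G}}$ is the set of (equivalence classes of) irreducible (continuous) unitary representations of $\mathbb{G}$; each class is represented by some $\pi:\mathbb{G}\to U(\mathbb{C}^{d_\pi})$, with $d_\pi$ its (finite) dimension, written as matrices in the standard basis $\{e_k\}$ of $\mathbb{C}^{d_\pi}$. $\pi(\gamma)=\int_{\mathbb{G}}\gamma(y)\pi(y)\,dy$ (entry-wise). The coefficient functions of $\pi$ are $\pi_{i,j}(x)=\langle\pi(x)e_i,e_j\rangle_{\mathbb{C}^{d_\pi}}$ (inner product linear in the first variable), $1\le i,j\le d_\pi$. An eigenbasis for a $d_\pi\times d_\pi$ matrix is a basis of $\mathbb{C}^{d_\pi}$ consisting of eigenvectors of the matrix; an (orthogonal) eigenbasis for $T_w$ is an (orthogonal) Hilbert space basis of $L^2(\mathbb{G})$ consisting of eigenvectors of $T_w$.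
   Formalization: For arbitrary eigenbases the union is shown to be an eigenbasis of T_w (total, no element in the closed span of the others); it is shown to be orthogonal when each fixed eigenbasis of the conjugated π(γ) is orthogonal, without which orthogonality fails. *)

(* Defs.v *)
From HB Require Import structures.
From mathcomp Require Import all_boot all_order all_algebra.
From mathcomp Require Import all_classical all_reals all_analysis.
From mathcomp Require Import complex.

Set Implicit Arguments.
Unset Strict Implicit.
Unset Printing Implicit Defensive.

Import Order.TTheory GRing.Theory Num.Theory.
Import numFieldNormedType.Exports.

Local Open Scope classical_set_scope.
Local Open Scope ring_scope.

HB.mixin Record isTopologicalGroup G & PointedTopological G & Group G := {
  mulg_continuous : continuous (fun p : G * G => (p.1 * p.2)%g) ;
  invg_continuous : continuous (fun x : G => x^-1%g)
}.

(* MathComp-Analysis only defines measurable structures on pointed types;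
   the distinguished point plays no role and need not be the unit. *)
#[short(type="topologicalGroupType")]
HB.structure Definition TopologicalGroup :=
  {G of PointedTopological G & Group G & isTopologicalGroup G}.

Notation borel G := (g_sigma_algebraType (@open G)).

Section L2.
Context {d : measure_display} {T : measurableType d} {R : realType}.
Variable mu : {measure set T -> \bar R}.
Local Notation C := R[i].
Implicit Types (f g : T -> C) (B : set (T -> C)).

Definition cintegral f : C :=
  Complex (\int[mu]_x complex.Re (f x)) (\int[mu]_x complex.Im (f x)).

(* Elements of the complex space L^2(mu) are represented by functions, equality
   in L^2(mu) being equality almost everywhere. *)
Definition L2 : set (T -> C) :=
  [set f | (fun x => complex.Re (f x)) \in Lfun mu 2%:E /\
           (fun x => complex.Im (f x)) \in Lfun mu 2%:E].

Definition L2norm f : \bar R :=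
  Lnorm mu 2%:E (fun x => (Normc.normc (f x))%:E).

Definition L2dot f g : C := cintegral (fun x => f x * (g x)^*).

Definition lin_span B : set (T -> C) :=
  [set f | exists (n : nat) (c : 'I_n -> C) (b : 'I_n -> T -> C),
     (forall k, B (b k)) /\ f = (fun x => \sum_(k < n) c k * b k x)].

Definition L2_closed_span B : set (T -> C) :=
  [set f | L2 f /\ forall e : R, 0 < e ->
     exists2 g, lin_span B g & (L2norm (f \- g)%R < e%:E)%E].

(* A Hilbert space basis that need not be orthogonal: a total set none of whose
   elements lies in the closed span of the others.  For orthogonal sets this
   amounts to being total and not containing 0. *)
Definition hilbert_basis B :=
  [/\ B `<=` L2, L2 `<=` L2_closed_span B
    & forall b, B b -> ~ L2_closed_span (B `\ b) b].

Definition L2_orthogonal B :=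
  forall f g, B f -> B g -> f <> g -> L2dot f g = 0.

Definition L2_eigenvector (A : (T -> C) -> T -> C) f :=
  [/\ L2 f, ~ {ae mu, forall x, f x = 0}
    & exists l : C, {ae mu, forall x, A f x = l * f x}].

Definition L2_eigenbasis (A : (T -> C) -> T -> C) B :=
  hilbert_basis B /\ forall f, B f -> L2_eigenvector A f.

Definition L2_orthogonal_eigenbasis (A : (T -> C) -> T -> C) B :=
  L2_eigenbasis A B /\ L2_orthogonal B.

Definition integral_operator (w : T -> T -> R) f : T -> C :=
  fun x => cintegral (fun y => Complex (w x y) 0 * f y).

End L2.

Section Matrices.
Context {C : numClosedFieldType} {n : nat}.

Definition cdot (u v : 'cV[C]_n) : C := \sum_(k < n) u k 0 * (v k 0)^*.

Definition mx_eigenvector (A : 'M[C]_n) (v : 'cV[C]_n) :=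
  v != 0 /\ exists l : C, A *m v = l *: v.

Definition mx_eigenbasis (A : 'M[C]_n) (E : seq 'cV[C]_n) :=
  basis_of fullv E /\ forall v, v \in E -> mx_eigenvector A v.

Definition mx_orthogonal (E : seq 'cV[C]_n) :=
  forall u v, u \in E -> v \in E -> u != v -> cdot u v = 0.

End Matrices.

Section Representations.
Variables (R : realType) (G : topologicalGroupType).
Local Notation C := R[i].

(* R[i]^o is R[i] with the topology of its absolute value. *)
Record unitary_rep := UnitaryRep {
  rep_dim : nat ;
  rep_mx :> G -> 'M[C]_rep_dim ;
  rep_mxM : forall x y, rep_mx (x * y)%g = rep_mx x *m rep_mx y ;
  rep_mx_unitary : forall x, rep_mx x \is unitarymx ;
  rep_mx_continuous : forall i j, continuous (fun x => rep_mx x i j : C^o)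
}.

Definition irreducible_rep (pi : unitary_rep) :=
  (0 < rep_dim pi)%N /\
  forall V : {vspace 'cV[C]_(rep_dim pi)},
    (forall x v, v \in V -> pi x *m v \in V) -> V = 0%VS \/ V = fullv.

Definition equivalent_rep (pi rho : unitary_rep) :=
  exists U : 'M[C]_(rep_dim rho, rep_dim pi),
    [/\ U \is unitarymx, (map_mx Num.conj U)^T \is unitarymx
      & forall x, U *m pi x = rho x *m U].

(* Ghat contains exactly one representative of every class of irreducible
   unitary representations. *)
Definition unitary_dual (Ghat : set unitary_rep) :=
  [/\ forall pi, Ghat pi -> irreducible_rep pi,
      forall rho, irreducible_rep rho ->
        exists2 pi, Ghat pi & equivalent_rep pi rho
    & forall pi rho, Ghat pi -> Ghat rho -> equivalent_rep pi rho -> pi = rho].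

(* With the inner product linear in its first argument, this is the (j, i)
   entry of the matrix of pi x. *)
Definition rep_coef (pi : unitary_rep) (i j : 'I_(rep_dim pi)) (x : G) : C :=
  cdot (pi x *m delta_mx i 0) (delta_mx j 0).

Definition normalized_haar (mu : probability (borel G) R) :=
  forall (g : G) (A : set (borel G)), measurable A ->
    mu [set (g * x)%g | x in A] = mu A.

Definition cayley_function (gamma : borel G -> R) :=
  [/\ measurable_fun setT gamma, forall x, 0 <= gamma x <= 1
    & forall x : G, gamma x = gamma (x^-1)%g].

Definition cayley_graphon (gamma : borel G -> R) (x y : borel G) : R :=
  gamma ((x : G) * (y : G)^-1)%g.

Definition rep_integral (mu : probability (borel G) R) (gamma : borel G -> R)
    (pi : unitary_rep) : 'M[C]_(rep_dim pi) :=
  \matrix_(i, j) cintegral mu (fun y => Complex (gamma y) 0 * pi y i j).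

Definition coef_eigenfunctions (Ghat : set unitary_rep)
    (E : forall pi : unitary_rep, seq 'cV[C]_(rep_dim pi)) :
    set (borel G -> C) :=
  \bigcup_(pi in Ghat) \bigcup_(i in [set: 'I_(rep_dim pi)])
    [set (fun x => \sum_j z j 0 * rep_coef i j x) | z in [set` E pi]].

End Representations.

(* Main.v *)
(** The operator T_w commutes with right translations: substituting y = u^-1 x
turns T_w into the action of conj (pi gamma) on the z-coordinates of
sum_j z_j pi_(i,j), and Schur orthogonality gives minimality and orthogonality.

Totality is the Peter-Weyl theorem, proved here without compact operators.  If
the coefficients span a space N at positive distance from some f, the residuals
r_n of a minimizing sequence have autocorrelations converging uniformly to a
continuous symmetric kernel K <> 0 with K * m = 0 for every m in N.  The powers
(K * K)^n, divided by the n-th power of their growth rate, converge uniformly to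
a nonzero idempotent p with K * K * p = l p and l <> 0.  By Bessel's inequality
{f | f * p = f} has finite dimension at most |p|^2, left translation acts on it
by a finite-dimensional representation, and p is a combination of coefficients
of it, so p is in N and K * p = 0, a contradiction.

Continuity of convolutions comes from the L1-continuity of translations, which
holds for indicators of open sets by inner approximation with compact sets and
passes to all bounded Borel functions. *)

Require Import Defs.
From HB Require Import structures.
From mathcomp Require Import all_boot all_order all_algebra.
From mathcomp Require Import all_classical all_reals all_analysis.
From mathcomp Require Import sesquilinear spectral.
From mathcomp Require Import measurable_realfun complex zify ring lra.
Import Order.TTheory GRing.Theory Num.Theory.
Import numFieldNormedType.Exports.
Local Open Scope classical_set_scope.
Local Open Scope ring_scope.
Local Open Scope sesquilinear_scope.
Set Implicit Arguments.
Unset Strict Implicit.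
Unset Printing Implicit Defensive.

(** * Bounded measurable functions *)

(** Bounded functions make every integral finite, so the analysis runs without integrability side
    conditions; general L2 functions enter only at the end, by truncation. The analysis is also
    carried out over the reals, where convolution by a symmetric kernel is a symmetric operator.
    Nothing is lost: a real orthogonal representation is unitary over the complex numbers, and an L2
    function splits into real and imaginary parts. The obstacle is that minimizing sequences and
    powers of kernels are at first Cauchy only in L2. Convolution sends L2-bounded pairs to the
    uniform norm, so each limit is taken after one more convolution and is a genuine continuous
    function; [K] is nonzero because [K 1] is the limit of the squared norms of the residuals. Even
    powers are used because their values at the unit are squared norms, positive and log-convex,
    which yields the growth rate [l]. The fixed eigenbases may fail to be orthogonal, so minimality
    is tested against biorthogonal functions. *)

Definition bounded_measurable d (T : measurableType d) (R : realType)
    (f : T -> R) :=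
  measurable_fun setT f /\ exists M, forall x, `|f x| <= M.

Section BoundedMeasurable.
Context d (T : measurableType d) (R : realType).
Implicit Types f g : T -> R.
Local Notation bm := bounded_measurable.

Lemma bm_cst (c : R) : bm (fun _ : T => c).
Proof. by split; [exact: measurable_cst|exists `|c|]. Qed.

Lemma bmD f g : bm f -> bm g -> bm (fun x => f x + g x).
Proof.
move=> [mf [M fM]] [mg [N gN]]; split; first exact: measurable_funD.
by exists (M + N) => x; rewrite (le_trans (ler_normD _ _))// lerD.
Qed.

Lemma bmM f g : bm f -> bm g -> bm (fun x => f x * g x).
Proof.
move=> [mf [M fM]] [mg [N gN]]; split; first exact: measurable_funM.
by exists (M * N) => x; rewrite normrM ler_pM.
Qed.

Lemma bmZ c f : bm f -> bm (fun x => c * f x).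
Proof. exact/bmM/bm_cst. Qed.

Lemma bmN f : bm f -> bm (fun x => - f x).
Proof.
move=> [mf [M fM]]; split; first exact: measurableT_comp.
by exists M => x; rewrite normrN.
Qed.

Lemma bmB f g : bm f -> bm g -> bm (fun x => f x - g x).
Proof. by move=> bf bg; apply: bmD => //; exact: bmN. Qed.

Lemma bm_norm f : bm f -> bm (fun x => `|f x|).
Proof.
move=> [mf [M fM]]; split; first exact: measurableT_comp.
by exists M => x; rewrite normr_id.
Qed.

Lemma bm_sum (I : Type) (r : seq I) (F : I -> T -> R) :
  (forall i, bm (F i)) -> bm (fun x => \sum_(i <- r) F i x).
Proof.
move=> bF; elim: r => [|i r IH].
  by under eq_fun do rewrite big_nil; exact: bm_cst.
by under eq_fun do rewrite big_cons; exact: bmD.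
Qed.

Lemma bm_indic (A : set T) : measurable A -> bm (\1_A : T -> R).
Proof.
move=> mA; split; first exact: measurable_indic.
by exists 1 => x; rewrite indicE; case: (_ \in _); rewrite ?normr1 ?normr0.
Qed.

Lemma bm_comp d' (T' : measurableType d') (h : T' -> T) f :
  measurable_fun setT h -> bm f -> bm (fun x => f (h x)).
Proof.
move=> mh [mf [M fM]]; split; first exact: measurableT_comp.
by exists M => x; exact: fM.
Qed.

End BoundedMeasurable.
Arguments bm_cst {d T R}.

Section BoundedMeasurableIntegral.
Context d (T : measurableType d) (R : realType).
Implicit Types f g : T -> R.
Local Notation bm := bounded_measurable.
Variable mu : probability T R.

Lemma bm_integrable f : bm f -> mu.-integrable setT (EFin \o f).
Proof.
move=> [mf [M fM]]; apply: measurable_bounded_integrable => //.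
  by rewrite ltey_eq fin_num_measure.
exists M; split; first exact: num_real.
by move=> y My x _; exact: le_trans (fM x) (ltW My).
Qed.
Hint Resolve bm_integrable : core.

Lemma bm_integralD f g : bm f -> bm g ->
  \int[mu]_x (f x + g x) = \int[mu]_x f x + \int[mu]_x g x.
Proof. by move=> bf bg; rewrite RintegralD//; exact: bm_integrable. Qed.

Lemma bm_integralB f g : bm f -> bm g ->
  \int[mu]_x (f x - g x) = \int[mu]_x f x - \int[mu]_x g x.
Proof. by move=> bf bg; rewrite RintegralB//; exact: bm_integrable. Qed.

Lemma bm_integralZ c f : bm f ->
  \int[mu]_x (c * f x) = c * \int[mu]_x f x.
Proof. by move=> bf; rewrite RintegralZl//; exact: bm_integrable. Qed.

Lemma bm_integral_sum (I : Type) (r : seq I) (F : I -> T -> R) :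
  (forall i, bm (F i)) ->
  \int[mu]_x (\sum_(i <- r) F i x) = \sum_(i <- r) \int[mu]_x F i x.
Proof.
move=> bF; elim: r => [|i r IH].
  rewrite big_nil; under eq_Rintegral do rewrite big_nil.
  by rewrite Rintegral_cst// mul0r.
rewrite big_cons -IH -bm_integralD//; last exact: bm_sum.
by apply: eq_Rintegral => x _; rewrite big_cons.
Qed.

Lemma bm_integral_cst (c : R) : \int[mu]_(x in setT) c = c.
Proof. by rewrite Rintegral_cst// [X in fine X]probability_setT mulr1. Qed.

Lemma bm_integral_le f g : bm f -> bm g -> (forall x, f x <= g x) ->
  \int[mu]_x f x <= \int[mu]_x g x.
Proof. by move=> bf bg fg; apply: le_Rintegral => //; exact: bm_integrable. Qed.

Lemma bm_integral_norm f : bm f ->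
  `|\int[mu]_x f x| <= \int[mu]_x `|f x|.
Proof. by move=> bf; apply: le_normr_Rintegral => //; exact: bm_integrable. Qed.

Lemma bm_integral_bound f M : bm f -> (forall x, `|f x| <= M) ->
  `|\int[mu]_x f x| <= M.
Proof.
move=> bf fM; apply: le_trans (bm_integral_norm bf) _.
rewrite -[leRHS]bm_integral_cst; apply: bm_integral_le => //.
- exact: bm_norm.
- exact: bm_cst.
Qed.

Definition dot f g := \int[mu]_x (f x * g x).

Lemma dotC f g : dot f g = dot g f.
Proof. by apply: eq_Rintegral => x _; rewrite mulrC. Qed.

Lemma dotDl f1 f2 g : bm f1 -> bm f2 -> bm g ->
  dot (fun x => f1 x + f2 x) g = dot f1 g + dot f2 g.
Proof.
move=> *; rewrite -bm_integralD; [|exact: bmM..].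
by apply: eq_Rintegral => x _; rewrite mulrDl.
Qed.

Lemma dotBl f1 f2 g : bm f1 -> bm f2 -> bm g ->
  dot (fun x => f1 x - f2 x) g = dot f1 g - dot f2 g.
Proof.
move=> *; rewrite -bm_integralB; [|exact: bmM..].
by apply: eq_Rintegral => x _; rewrite mulrBl.
Qed.

Lemma dotBr f g1 g2 : bm f -> bm g1 -> bm g2 ->
  dot f (fun x => g1 x - g2 x) = dot f g1 - dot f g2.
Proof. by move=> *; rewrite dotC dotBl// dotC (dotC g2). Qed.

Lemma dotZl c f g : bm f -> bm g -> dot (fun x => c * f x) g = c * dot f g.
Proof.
move=> *; rewrite -bm_integralZ; last exact: bmM.
by apply: eq_Rintegral => x _; rewrite mulrA.
Qed.

Lemma dotZr c f g : bm f -> bm g -> dot f (fun x => c * g x) = c * dot f g.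
Proof. by move=> *; rewrite dotC dotZl// dotC. Qed.

Lemma dot_suml (I : Type) (r : seq I) (F : I -> T -> R) g :
  (forall i, bm (F i)) -> bm g ->
  dot (fun x => \sum_(i <- r) F i x) g = \sum_(i <- r) dot (F i) g.
Proof.
move=> bF bg; rewrite -bm_integral_sum; last by move=> i; exact: bmM.
by apply: eq_Rintegral => x _; rewrite mulr_suml.
Qed.

Lemma dot_ge0 f : 0 <= dot f f.
Proof. by apply: Rintegral_ge0 => x _; exact: sqr_ge0. Qed.

Lemma dot_sqB f g : bm f -> bm g ->
  dot (fun x => f x - g x) (fun x => f x - g x) = dot f f - 2 * dot f g + dot g g.
Proof.
move=> bf bg; rewrite dotBl ?dotBr//; [|exact: bmB..].
by rewrite (dotC g f); ring.
Qed.

(** The squared norm of [f - t g] is a quadratic polynomial in [t] that is nowhere negative. *)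
Lemma cauchy_schwarz_sq f g : bm f -> bm g ->
  dot f g ^+ 2 <= dot f f * dot g g.
Proof.
move=> bf bg.
have H t : 0 <= dot f f - 2 * t * dot f g + t ^+ 2 * dot g g.
  have := dot_ge0 (fun x => f x - t * g x).
  rewrite dot_sqB// ?dotZr ?dotZl//; [|exact: bmZ..].
  by congr (_ <= _); ring.
have g0 := dot_ge0 g; have f0 := dot_ge0 f.
have [gg0|gg0] := eqVneq (dot g g) 0.
  rewrite gg0 mulr0.
  have {}H t : 0 <= dot f f - 2 * t * dot f g by have := H t; rewrite gg0 mulr0 addr0.
  have [->|fg0] := eqVneq (dot f g) 0; first by rewrite expr0n.
  (* With [dot g g = 0] the polynomial is affine; this [t] gives it the value -1. *)
  have := H ((dot f f + 1) / 2 / dot f g).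
  rewrite (_ : 2 * _ * _ = dot f f + 1); last by field.
  by rewrite opprD addrA subrr; lra.
have gp : 0 < dot g g by rewrite lt_def gg0.
(* The minimizer of the quadratic. *)
have := H (dot f g / dot g g).
rewrite (_ : _ - _ + _ = (dot f f * dot g g - dot f g ^+ 2) / dot g g); last by field.
by rewrite pmulr_lge0 ?invr_gt0// subr_ge0.
Qed.

Lemma cauchy_schwarz f g : bm f -> bm g ->
  `|dot f g| <= Num.sqrt (dot f f) * Num.sqrt (dot g g).
Proof.
move=> bf bg; rewrite -sqrtrM ?dot_ge0// -sqrtr_sqr.
by rewrite ler_wsqrtr// cauchy_schwarz_sq.
Qed.

End BoundedMeasurableIntegral.

(** * Fubini for bounded functions *)

Section Fubini.
Context d (T : measurableType d) (R : realType) (mu : probability T R).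
Implicit Types F : T * T -> R.
Local Notation bm := bounded_measurable.

Lemma bm_section1 F x : bm F -> bm (fun y => F (x, y)).
Proof. by apply: bm_comp; exact: pair1_measurable. Qed.

Lemma bm_section2 F y : bm F -> bm (fun x => F (x, y)).
Proof. by apply: (bm_comp (h := pair^~ y)); exact: pair2_measurable. Qed.

Lemma bm_swap F : bm F -> bm (fun z => F (z.2, z.1)).
Proof.
apply: (bm_comp (h := fun z : T * T => (z.2, z.1))).
by apply: measurable_fun_pair; [exact: measurable_snd|exact: measurable_fst].
Qed.

Lemma bm_prod_integrable F : bm F ->
  (mu \x mu)%E.-integrable setT (EFin \o F).
Proof. exact: (bm_integrable (mu \x mu)%E). Qed.

Lemma bm_fubini_bm F : bm F -> bm (fun x => \int[mu]_y F (x, y)).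
Proof.
move=> bF; split.
  rewrite /Rintegral; apply: measurableT_comp => //.
  exact: (measurable_fubini_F (bm_prod_integrable bF)).
have [_ [M FM]] := bF; exists M => x.
by apply: bm_integral_bound => //; exact: bm_section1.
Qed.

Lemma bm_fubini F : bm F ->
  \int[mu]_x \int[mu]_y F (x, y) = \int[mu]_y \int[mu]_x F (x, y).
Proof.
move=> bF; rewrite /Rintegral; congr fine.
transitivity (\int[mu]_x \int[mu]_y (F (x, y))%:E)%E.
  apply: eq_integral => x _; rewrite fineK// integrable_fin_num// bm_integrable//.
  exact: bm_section1.
rewrite (Fubini (bm_prod_integrable bF)).
apply: eq_integral => y _; rewrite [RHS]fineK// integrable_fin_num// bm_integrable//.
exact: bm_section2.
Qed.

End Fubini.

(** * The Haar measure *)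

Lemma bm_integral_preserving d (T : measurableType d) (R : realType)
    (mu : probability T R) (h : T -> T) (f : T -> R) :
  measurable_fun setT h ->
  (forall A, measurable A -> mu (h @^-1` A) = mu A) ->
  bounded_measurable f -> \int[mu]_x f (h x) = \int[mu]_x f x.
Proof.
move=> mh muh bf; rewrite /Rintegral; congr fine.
have mf : measurable_fun setT (EFin \o f) by exact/measurable_EFinP/(proj1 bf).
have := @integral_pushforward _ _ _ _ R h mh mu setT (EFin \o f) mf.
rewrite preimage_setT => <- //; last first.
  exact/(bm_integrable mu)/(bm_comp mh).
by apply: eq_measure_integral => A mA _; exact: muh.
Qed.

(** * Countable bases and measurability of the group operations *)

Lemma second_countable_sequence (T : topologicalType) : @second_countable T ->
  exists U : nat -> set T, (forall n, open (U n)) /\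
    forall x V, nbhs x V -> exists2 n, U n x & U n `<=` V.
Proof.
case=> B /countable_injP[f finj] [Bo Bx].
(* By injectivity of [f] the union has at most one member; an index that codes no basic set gives
   the empty set. *)
exists (fun n => \bigcup_(b in [set b | B b /\ f b = n]) b); split.
  by move=> n; apply: bigcup_open => b [/Bo].
move=> x V /Bx [b [Bb bx] bV]; exists (f b); first by exists b.
move=> y [b' [Bb' ff] b'y]; apply: bV.
by rewrite (finj b b') ?inE//.
Qed.

Lemma countable_bigcup_measurable d (T : measurableType d) (I : choiceType)
    (D : set I) (F : I -> set T) : countable D ->
  (forall i, D i -> measurable (F i)) -> measurable (\bigcup_(i in D) F i).
Proof.
move=> cD mF; have [->|/set0P[i0 Di0]] := eqVneq D set0; first by rewrite bigcup0.
have [f fD] : exists f : nat -> I, D `<=` range f /\ forall n, D (f n).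
  have /countable_injP[g ginj] := cD.
  exists (fun n => xget i0 [set i | D i /\ g i = n]); split.
    move=> i Di; exists (g i) => //; case: xgetP => [j _ [Dj gji]|/(_ i) []//].
    by apply: ginj; rewrite ?inE.
  by move=> n; case: xgetP => [j _ []|].
rewrite (_ : \bigcup_(i in D) F i = \bigcup_n F (f n)).
  by apply: bigcupT_measurable => n; exact/mF/(proj2 fD).
apply/seteqP; split=> x [].
  by move=> i /(proj1 fD) [n _ <-] ?; exists n.
by move=> n _ ?; exists (f n) => //; exact: (proj2 fD).
Qed.

Section Borel.
Variables (R : realType) (G : topologicalGroupType).
Local Notation bm := (@bounded_measurable _ (borel G) R).

Lemma open_borel (A : set (borel G)) : @open G A -> measurable A.
Proof. by move=> oA; exact: sub_sigma_algebra. Qed.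

Lemma closed_borel (A : set (borel G)) : @closed G A -> measurable A.
Proof.
move=> cA; rewrite -(setCK A); apply: measurableC.
by apply: open_borel; rewrite openC.
Qed.

Lemma borel_measurability d (T : measurableType d) (f : T -> borel G) :
  (forall O, @open G O -> measurable (f @^-1` O)) -> measurable_fun setT f.
Proof.
move=> fO; apply: (@measurability _ _ _ _ setT f (@open G)) => //.
by move=> _ [V oV <-]; rewrite setTI; exact: fO.
Qed.

Lemma continuous_borel (f : G -> G) : continuous f ->
  measurable_fun (setT : set (borel G)) (f : borel G -> borel G).
Proof.
move=> /continuousP cf; apply: borel_measurability => O oO.
by apply: open_borel; exact: cf.
Qed.

Lemma continuous_borel_real (f : G -> R) : continuous f ->
  measurable_fun (setT : set (borel G)) (f : borel G -> R).
Proof.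
move=> /continuousP cf.
apply: (measurability _ (RGenOpens.measurableE R)).
move=> _ [_ [a [b ->] <-]]; rewrite setTI; apply: open_borel; apply: cf.
exact: interval_open.
Qed.

Lemma mulg_cvg (x y : G) : (fun p : G * G => (p.1 * p.2)%g) @ (x, y) --> (x * y)%g.
Proof. exact: (@mulg_continuous G (x, y)). Qed.

Lemma mulgl_continuous (g : G) : continuous (fun x : G => (g * x)%g).
Proof.
move=> x; exact: (cvg_comp2 (cvg_cst g) cvg_id (@mulg_cvg g x)).
Qed.

Lemma mulgr_continuous (g : G) : continuous (fun x : G => (x * g)%g).
Proof.
move=> x; exact: (cvg_comp2 cvg_id (cvg_cst g) (@mulg_cvg x g)).
Qed.

Lemma bm_mulgl (g : G) f : bm f -> bm (fun x => f (g * x)%g).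
Proof. exact: (bm_comp (continuous_borel (@mulgl_continuous g))). Qed.

Lemma bm_mulgr (g : G) f : bm f -> bm (fun x => f (x * g)%g).
Proof. exact: (bm_comp (continuous_borel (@mulgr_continuous g))). Qed.

Lemma bm_invg f : bm f -> bm (fun x => f (x : G)^-1%g).
Proof. exact: (bm_comp (continuous_borel (@invg_continuous G))). Qed.

Hypothesis G2 : @second_countable G.

(** The product sigma-algebra is generated by measurable rectangles, so continuity alone does not
    suffice: a countable base writes the preimage of an open set as a countable union of open
    rectangles. *)
Lemma mulg_borel :
  measurable_fun setT (fun z : borel G * borel G => (z.1 : G) * z.2 : borel G)%g.
Proof.
apply: borel_measurability => O oO.
have [U [Uo Unbhs]] := second_countable_sequence G2.
pose D := [set p : nat * nat | forall x y, U p.1 x -> U p.2 y -> O (x * y)%g].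
rewrite (_ : _ @^-1` _ = \bigcup_(p in D) (U p.1 `*` U p.2)).
  apply: countable_bigcup_measurable => [|p _]; first exact: countableP.
  by apply: measurableX; exact: open_borel.
apply/seteqP; split=> [[x y] /= Oxy|[x y] [p Dp] [/= px py]]; last exact: Dp.
have [[V W] /= [Vx Wy] VW] := @mulg_cvg x y O (open_nbhs_nbhs (conj oO Oxy)).
have [n nx nV] := Unbhs x V Vx; have [m my mW] := Unbhs y W Wy.
by exists (n, m) => //= a b /nV Va /mW Wb; exact: (VW (a, b)).
Qed.

Lemma mulVg_borel :
  measurable_fun setT (fun z : borel G * borel G => (z.1 : G)^-1 * z.2 : borel G)%g.
Proof.
suff H : measurable_fun setT
    (fun z : borel G * borel G => (((z.1 : G)^-1)%g : borel G, z.2)).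
  exact: (measurableT_comp mulg_borel H).
apply: measurable_fun_pair; last exact: measurable_snd.
exact: (measurableT_comp (continuous_borel (@invg_continuous G)) measurable_fst).
Qed.

End Borel.

(** * Invariance of the Haar integral and L1-continuity of translations *)

Section Haar.
Variables (R : realType) (G : topologicalGroupType).
Local Notation bm := (@bounded_measurable _ (borel G) R).
Variables (mu : probability (borel G) R) (mu_haar : normalized_haar mu).

Lemma haar_mull (g : G) f : bm f ->
  \int[mu]_x f (g * (x : G))%g = \int[mu]_x f x.
Proof.
apply: (bm_integral_preserving (h := fun x : borel G => (g * (x : G))%g : borel G)).
  exact: (continuous_borel (@mulgl_continuous G g)).
move=> A mA; rewrite -[RHS](mu_haar g^-1%g mA); congr (mu _).
apply/seteqP; split=> [x Ax|_ [y Ay <-] /=]; last by rewrite mulgA mulgV mul1g.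
by exists (g * (x : G))%g => //; rewrite mulgA mulVg mul1g.
Qed.

Hypothesis G2 : @second_countable G.

(** Integrate [f (x^-1 * y)] in both orders. The integral over [y] is that of [f] by left
    invariance; the integral over [x], after replacing [x] by [y * x], is that of [f] composed with
    inversion. Both are constant and the total mass is 1. *)
Lemma haar_invg f : bm f -> \int[mu]_x f (x : G)^-1%g = \int[mu]_x f x.
Proof.
move=> bf.
have bF : bounded_measurable
    (fun z : borel G * borel G => f ((z.1 : G)^-1 * (z.2 : G))%g).
  exact: (bm_comp (mulVg_borel G2)).
have := bm_fubini mu bF => /=.
under eq_Rintegral do rewrite haar_mull//.
rewrite bm_integral_cst => ->.
under [RHS]eq_Rintegral => y _.
  have bFy : bm (fun x : borel G => f ((x : G)^-1 * (y : G))%g).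
    by apply: (bm_invg (f := fun x : borel G => f ((x : G) * (y : G))%g)); exact: bm_mulgr.
  rewrite -(haar_mull (y : G) bFy).
  under eq_Rintegral do rewrite invgM -mulgA mulVg mulg1.
  over.
by rewrite bm_integral_cst.
Qed.

Lemma haar_mulr (g : G) f : bm f ->
  \int[mu]_x f ((x : G) * g)%g = \int[mu]_x f x.
Proof.
move=> bf; rewrite -(haar_invg bf) -(haar_mull (g^-1)%g (bm_invg bf)).
under [RHS]eq_Rintegral do rewrite invgM invgK.
rewrite -(haar_invg (bm_mulgr g bf)).
by [].
Qed.

(** L1-continuity of left translation, stated at the unit only; invariance of the measure transports
    it to the other points. *)
Definition translation_continuous (f : G -> R) :=
  forall e, 0 < e -> \forall x \near (1%g : G),
    \int[mu]_y `|f (x^-1 * (y : G))%g - f y| < e.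
Local Notation tc := translation_continuous.

Lemma bm_translate_diff f x : bm f ->
  bm (fun y => `|f (x^-1 * (y : G))%g - f y|).
Proof. by move=> bf; apply: bm_norm; apply: bmB => //; exact: bm_mulgl. Qed.

(** Translation is an L1 isometry, so the class is closed under L1 limits by the usual splitting
    into three thirds. *)
Lemma tc_approx f : bm f ->
  (forall e, 0 < e -> exists s, [/\ bm s, tc s & \int[mu]_y `|f y - s y| < e]) ->
  tc f.
Proof.
move=> bf H e e0; have [|s [bs tcs se]] := H (e / 3); first by lra.
have e30 : 0 < e / 3 by lra.
apply: filterS (tcs _ e30) => x xe.
have bfs : bm (fun y => `|f y - s y|) by apply: bm_norm; exact: bmB.
apply: (@le_lt_trans _ _ (\int[mu]_y (`|f (x^-1 * (y : G))%g - s (x^-1 * (y : G))%g|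
   + (`|s (x^-1 * (y : G))%g - s y| + `|f y - s y|)))).
  apply: bm_integral_le => [||y].
  - exact: bm_translate_diff.
  - apply: bmD; first exact: (bm_mulgl x^-1%g bfs).
    by apply: bmD => //; exact: bm_translate_diff.
  - rewrite (distrC (f y) (s y)) addrA.
    apply: le_trans (ler_distD (s y) _ _) _; rewrite lerD2r.
    exact: ler_distD.
rewrite bm_integralD; [|exact: (bm_mulgl x^-1%g bfs)|]; last first.
  by apply: bmD => //; exact: bm_translate_diff.
rewrite bm_integralD//; last exact: bm_translate_diff.
rewrite (haar_mull x^-1%g bfs); lra.
Qed.

(** A single estimate that serves both sums and indicators of unions. *)
Lemma tc_dominated f g h : bm f -> bm g -> bm h -> tc f -> tc g ->
  (forall x y, `|h x - h y| <= `|f x - f y| + `|g x - g y|) -> tc h.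
Proof.
move=> bf bg bh tf tg H e e0.
have e20 : 0 < e / 2 by lra.
near=> x.
apply: (@le_lt_trans _ _ (\int[mu]_y (`|f (x^-1 * (y : G))%g - f y|
  + `|g (x^-1 * (y : G))%g - g y|))).
  apply: bm_integral_le => //.
  - exact: bm_translate_diff.
  - by apply: bmD; exact: bm_translate_diff.
rewrite bm_integralD; [|exact: bm_translate_diff..].
rewrite [ltRHS]splitr ltrD//; near: x; [exact: tf|exact: tg].
Unshelve. all: by end_near. Qed.

Lemma tcD f g : bm f -> bm g -> tc f -> tc g -> tc (fun x => f x + g x).
Proof.
move=> bf bg tf tg; apply: (tc_dominated bf bg) => //; first exact: bmD.
move=> x y; rewrite (_ : _ - _ = (f x - f y) + (g x - g y)); last by ring.
exact: ler_normD.
Qed.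

Lemma tc_cst c : tc (fun _ => c).
Proof.
move=> e e0; apply: nearW => x; rewrite subrr normr0.
by rewrite (bm_integral_cst mu).
Qed.

Lemma tcZ c f : bm f -> tc f -> tc (fun x => c * f x).
Proof.
move=> bf tf e e0.
have c0 : 0 < `|c| + 1 by rewrite ltr_wpDl.
have e'0 : 0 < e / (`|c| + 1) by rewrite divr_gt0.
apply: filterS (tf _ e'0) => x.
under [in X in _ -> X]eq_Rintegral do rewrite -mulrBr normrM.
rewrite bm_integralZ; last exact: bm_translate_diff.
rewrite ltr_pdivlMr// => H; apply: le_lt_trans H.
by rewrite mulrC ler_wpM2l// ?lerDl// Rintegral_ge0.
Qed.

Hypothesis Gh : hausdorff_space G.
Hypothesis Gc : compact [set: G].

Lemma indic_integral (A : set (borel G)) : measurable A ->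
  \int[mu]_x (\1_A x : R) = fine (mu A).
Proof. by move=> mA; rewrite /Rintegral integral_indic// setIT. Qed.

Lemma bigcup_approx (A : nat -> set (borel G)) : (forall n, measurable (A n)) ->
  forall e, 0 < e -> exists n, \int[mu]_x
    `|\1_(\bigcup_n A n) x - \1_(\big[setU/set0]_(i < n) A i) x| < e.
Proof.
move=> mA e e0; pose B n := \big[setU/set0]_(i < n) A i.
have mB n : measurable (B n) by exact: bigsetU_measurable.
have mU : measurable (\bigcup_n A n) by exact: bigcupT_measurable.
have BU n : B n `<=` \bigcup_n A n.
  by rewrite /B -bigcup_mkord => x [i _ ?]; exists i.
have UB : \bigcup_n A n = \bigcup_n B n.
  apply/seteqP; split=> x [n _]; last by move=> /BU.
  by move=> Anx; exists n.+1 => //; rewrite /B -bigcup_mkord; exists n => /=.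
have : (mu \o B) n @[n --> \oo] --> mu (\bigcup_n B n).
  apply: nondecreasing_cvg_mu => //; first by rewrite -UB.
  by move=> m n mn; rewrite subsetEset; exact: subset_bigsetU.
rewrite -UB -[X in _ --> X]fineK; last exact: fin_num_measure.
move=> /fine_cvgP[_] /cvgrPdist_lt /(_ e e0) [n _ /(_ n (leqnn n))/= H].
have bU : bm \1_(\bigcup_n A n) by exact: bm_indic.
have bB : bm \1_(B n) by exact: bm_indic.
exists n; apply: le_lt_trans H; rewrite -!indic_integral// -bm_integralB//.
apply: le_trans (ler_norm _); apply: bm_integral_le => [||x].
- by apply: bm_norm; exact: bmB bU bB.
- exact: bmB bU bB.
rewrite ger0_norm// subr_ge0 !indicE ler_nat.
case: (boolP (x \in \big[setU/set0]_(i < n) A i)) => //; rewrite inE => /BU Ux.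
by rewrite mem_set.
Qed.

Lemma tc_indicU (A B : set (borel G)) : measurable A -> measurable B ->
  tc \1_A -> tc \1_B -> tc \1_(A `|` B).
Proof.
move=> mA mB tA tB.
apply: (@tc_dominated \1_A \1_B) => //; try exact: bm_indic.
  by apply: bm_indic; exact: measurableU.
move=> x y; rewrite !indicE !in_setU.
by do 4 case: (_ \in _); rewrite /= ?subrr ?normr0 ?subr0 ?sub0r ?normrN ?normr1; lra.
Qed.

Lemma tc_indic_bigU (A : nat -> set (borel G)) : (forall n, measurable (A n)) ->
  (forall n, tc \1_(A n)) -> tc \1_(\bigcup_n A n).
Proof.
move=> mA tA; apply: tc_approx; first by apply: bm_indic; exact: bigcupT_measurable.
move=> e e0; have [n H] := bigcup_approx mA e0.
exists \1_(\big[setU/set0]_(i < n) A i); split => //.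
  by apply: bm_indic; exact: bigsetU_measurable.
elim: n {H} => [|n IH]; first by rewrite big_ord0 indic0; exact: tc_cst.
by rewrite big_ord_recr /=; apply: tc_indicU => //; exact: bigsetU_measurable.
Qed.

Lemma tc_indicC (A : set (borel G)) : tc \1_A -> tc \1_(~` A).
Proof.
move=> tA e e0; apply: filterS (tA e e0) => x; apply: le_lt_trans.
rewrite le_eqVlt; apply/orP; left; apply/eqP/eq_Rintegral => y _.
rewrite !indicE !in_setC.
by do 2 case: (_ \in _); rewrite /= ?subrr ?normr0 ?subr0 ?sub0r ?normrN ?normr1.
Qed.

Lemma open_sigma_compact (A : set G) : open A -> exists F : nat -> set G,
  (forall n, closed (F n)) /\ A = \bigcup_n F n.
Proof.
move=> oA; have [U [Uo Unbhs]] := second_countable_sequence G2.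
(* Basic sets whose closure leaves [A] contribute the empty set; regularity of a compact Hausdorff
   space ensures that the others cover [A]. *)
pose F n := [set x | closure (U n) `<=` A /\ closure (U n) x].
exists F; split=> [n|].
  have [H|H] := pselect (closure (U n) `<=` A).
    rewrite (_ : F n = closure (U n)); first exact: closed_closure.
    by apply/seteqP; split=> x //; case.
  rewrite (_ : F n = set0); first exact: closed0.
  by apply/seteqP; split=> x //; case.
apply/seteqP; split=> [x Ax|x [n _ [/[apply]]]//].
have xA : nbhs x A by exact: open_nbhs_nbhs.
have [V Vx VA] := compact_regular Gh Gc (@filterT _ (nbhs x) _) xA.
have [n nx nV] := Unbhs x V Vx.
exists n => //; split; last exact: subset_closure.
exact: subset_trans (closureS nV) VA.
Qed.

(** The tube lemma: compactness of [F] turns neighborhoods of the unit that depend on [y] into one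
    that works for all of [F]. *)
Lemma tube_mulg (F A : set G) : closed F -> open A -> F `<=` A ->
  \forall x \near (1%g : G), forall y, F y -> A (x * y)%g.
Proof.
move=> cF oA FA.
have /compact_near_coveringP kF : compact F by apply: subclosed_compact Gc _.
apply: (kF G (nbhs (1%g : G)) (fun x y => A (x * y)%g)) => y Fy.
have := @mulg_cvg G 1%g y A; rewrite mul1g => H.
have {}H := H (open_nbhs_nbhs (conj oA (FA _ Fy))).
case: H => [[V W] /= [V1 Wy] VW]; exists (W, V) => //= -[b a] [/= Wb Va].
exact: (VW (a, b)).
Qed.

(** Choose a compact [K] in [A] missing measure less than [e / 3]. For [x] near the unit both [x K]
    and [x^-1 K] lie in [A], so the indicators of [A] and [x A] differ only on [A] minus [K] and on
    its translate by [x]. *)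
Lemma tc_indic_open (A : set G) : open A -> tc \1_A.
Proof.
move=> oA e e0; have [F [cF AF]] := open_sigma_compact oA.
have e30 : 0 < e / 3 by lra.
have mF n : measurable (F n : set (borel G)) by exact: closed_borel.
have [n] := bigcup_approx mF e30; rewrite -AF.
set K := \big[setU/set0]_(i < n) F i => H.
have mK : measurable (K : set (borel G)) by exact: bigsetU_measurable.
have cK : closed K by apply: closed_bigsetU => *; exact: cF.
have KA : K `<=` A by rewrite AF /K -bigcup_mkord => x [i _ ?]; exists i.
have mA : measurable (A : set (borel G)) by exact: open_borel.
have bAK : bm (fun y => `|\1_A y - \1_K y|) by apply: bm_norm; apply: bmB; exact: bm_indic.
have near1 : \forall x \near (1%g : G), forall y, K y -> A (x^-1 * y)%g.
  have cV : (fun x : G => x^-1%g) @ (1%g : G) --> (1%g : G).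
    by rewrite -[X in _ --> X]invg1; exact: invg_continuous.
  exact: (cV _ (tube_mulg cK oA KA)).
apply: filterS2 (tube_mulg cK oA KA) near1 => x Kx Kx1.
apply: (@le_lt_trans _ _ (\int[mu]_y (`|\1_A (x^-1 * (y : G))%g - \1_K (x^-1 * (y : G))%g|
   + `|\1_A y - \1_K y|))).
  apply: bm_integral_le => [||y].
  - by apply: bm_translate_diff; exact: bm_indic.
  - by apply: bmD => //; exact: (bm_mulgl x^-1%g bAK).
  have K1 : K (x^-1 * (y : G))%g -> A y by move=> /Kx; rewrite mulgA mulgV mul1g.
  have K2 := Kx1 y; have K3 := KA y; have K4 := KA (x^-1 * (y : G))%g.
  rewrite !indicE.
  have E (B : set (borel G)) z : (z \in B) = `[< B z >].
    by apply/idP/asboolP; rewrite inE.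
  rewrite !E.
  do 4 case: asboolP => ?; try (by tauto);
    rewrite /= ?subrr ?normr0 ?subr0 ?sub0r ?normrN ?normr1; lra.
rewrite bm_integralD//; last exact: (bm_mulgl x^-1%g bAK).
rewrite (haar_mull x^-1%g bAK); lra.
Qed.

Lemma tc_indic_borel (A : set (borel G)) : measurable A -> tc \1_A.
Proof.
move=> mA; suff [] : measurable A /\ tc \1_A by [].
pose S := [set A : set (borel G) | measurable A /\ tc \1_A].
suff : <<s @open G >> `<=` S by apply.
apply: smallest_sub => [|B oB]; last by split; [exact: open_borel|exact: tc_indic_open].
split=> [|B [mB tB]|F SF].
- by split => //; rewrite indic0; exact: tc_cst.
- by rewrite setTD; split; [exact: measurableC|exact: tc_indicC].
- split; first by apply: bigcupT_measurable => n; exact: (SF n).1.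
  by apply: tc_indic_bigU => n; [exact: (SF n).1|exact: (SF n).2].
Qed.

(** Binary expansion: subtracting [c / 2] where [f] is at least [c / 2] leaves a function with
    values between 0 and [c / 2]. *)
Lemma bm_dyadic_approx n (c : R) f : bm f -> (forall x, 0 <= f x <= c) ->
  exists s, [/\ bm s, tc s & forall x, 0 <= f x - s x <= c / 2 ^+ n].
Proof.
elim: n c f => [|n IH] c f bf f0c.
  exists (fun=> 0); split; [exact: bm_cst|exact: tc_cst|].
  by move=> x; rewrite subr0 expr0 divr1.
pose A := [set x : borel G | c / 2 <= f x].
have mA : measurable A.
  rewrite (_ : A = f @^-1` `[c / 2, +oo[); last first.
    by apply/seteqP; split=> x /=; rewrite in_itv/= andbT.
  by rewrite -[_ @^-1` _]setTI; apply: (proj1 bf) => //; exact: measurable_itv.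
have bA : bm (fun x => c / 2 * \1_A x) by apply: bmZ; exact: bm_indic.
have [||s [bs ts fs]] := IH (c / 2) (fun x => f x - c / 2 * \1_A x).
- exact: bmB.
- move=> x; have := f0c x; rewrite indicE.
  have [Ax|Ax] := pselect (A x); rewrite ?(mem_set Ax) ?(memNset Ax)/=.
    by move: Ax; rewrite /A/= => ?; lra.
  by move: Ax => /negP; rewrite -ltNge => ?; lra.
exists (fun x => c / 2 * \1_A x + s x); split.
- exact: bmD.
- by apply: tcD => //; apply: tcZ; [exact: bm_indic|exact: tc_indic_borel].
- by move=> x; rewrite opprD addrA exprS invfM mulrA; exact: fs.
Qed.

Lemma bm_tc f : bm f -> tc f.
Proof.
move=> bf; have [_ [M fM]] := bf.
have bg : bm (fun x => f x + M) by apply: bmD => //; exact: bm_cst.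
have tg : tc (fun x => f x + M).
  apply: tc_approx => // e e0.
  have gM x : 0 <= f x + M <= 2 * M by have := fM x; rewrite ler_norml; lra.
  have [n He] : exists n, 2 * M / 2 ^+ n < e.
    have M0 : 0 <= M by apply: le_trans (fM point).
    have xe0 : 0 <= 2 * M / e by rewrite divr_ge0 ?mulr_ge0// ltW.
    (* Any integer [n] above [2 * M / e] works, because [2 ^+ n] exceeds [n]. *)
    exists (Num.bound (2 * M / e)).
    rewrite ltr_pdivrMr ?exprn_gt0// [ltRHS]mulrC -ltr_pdivrMr//.
    apply: (lt_le_trans (archi_boundP xe0)).
    by rewrite -natrX ler_nat ltnW// ltn_expl.
  have [s [bs ts gs]] := bm_dyadic_approx n bg gM.
  exists s; split => //; apply: le_lt_trans He.
  rewrite -[leRHS](bm_integral_cst mu); apply: bm_integral_le => [||x].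
  - by apply: bm_norm; exact: bmB.
  - exact: bm_cst.
  - by have /andP[? ?] := gs x; rewrite ger0_norm.
have := tcD bg (bm_cst (- M)) tg (tc_cst _).
by under eq_fun do rewrite addrK.
Qed.

End Haar.

(** * Convolution and the power method *)

Definition uniform_cvg (T : Type) (R : realType) (u : nat -> T -> R) (p : T -> R) :=
  forall e, 0 < e -> exists N, forall n x, (N <= n)%N -> `|u n x - p x| <= e.

Section UniformConvergence.
Variables (T : Type) (R : realType).
Implicit Types (u : nat -> T -> R) (p : T -> R).

Lemma uniform_cauchy_cvg u :
  (forall e, 0 < e -> exists N, forall n m x, (N <= n)%N -> (N <= m)%N ->
    `|u n x - u m x| <= e) -> exists p, uniform_cvg u p.
Proof.
move=> H.
have cu x : cvgn (u ^~ x).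
  apply/cauchy_cvgP/cauchyP => e e0.
  have e20 : 0 < e / 2 by rewrite divr_gt0.
  have [N HN] := H _ e20.
  exists (u N x); exists N => // n /= Nn; rewrite /ball /=.
  apply: le_lt_trans (HN N n x (leqnn _) Nn) _.
  by rewrite ltr_pdivrMr// mulrC mulr_natl mulr2n ltrDl.
exists (fun x => limn (u ^~ x)) => e e0; have [N HN] := H e e0.
exists N => n x Nn.
have : (`|u n x - u m x|) @[m --> \oo] --> `|u n x - limn (u ^~ x)|.
  by apply: cvg_norm; apply: cvgB; [exact: cvg_cst|exact: cu].
move=> /cvg_lim <- //; apply: limr_le.
  by apply: is_cvg_norm; apply: is_cvgB; [exact: is_cvg_cst|exact: cu].
by exists N => // m /= Nm; exact: HN.
Qed.

Lemma uniform_cvg_unique u p p' : uniform_cvg u p -> uniform_cvg u p' -> p = p'.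
Proof.
move=> up up'; apply/funext => x; apply/eqP; rewrite -subr_eq0 -normr_le0.
apply/ler_addgt0Pl => e e0; rewrite addr0.
have e20 : 0 < e / 2 by rewrite divr_gt0.
have [N HN] := up _ e20; have [N' HN'] := up' _ e20.
have := HN _ x (leq_maxl N N'); have := HN' _ x (leq_maxr N N').
set y := u _ x; rewrite !ler_norml; lra.
Qed.

Lemma uniform_cvg_shift u p k : uniform_cvg u p -> uniform_cvg (fun n => u (n + k)%N) p.
Proof.
move=> up e e0; have [N HN] := up e e0; exists N => n x Nn.
by apply: HN; exact: leq_trans (leq_addr _ _).
Qed.

Lemma uniform_cvg_cst p : uniform_cvg (fun=> p) p.
Proof. by move=> e e0; exists 0%N => n x _; rewrite subrr normr0 ltW. Qed.

Lemma uniform_cvgZ c u p : uniform_cvg u p ->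
  uniform_cvg (fun n x => c * u n x) (fun x => c * p x).
Proof.
move=> up e e0; have c0 : 0 < `|c| + 1 by rewrite ltr_wpDl.
have [N HN] := up (e / (`|c| + 1)) (divr_gt0 e0 c0); exists N => n x Nn.
rewrite -mulrBr normrM; have := HN n x Nn; rewrite ler_pdivlMr// mulrC => H.
by apply: le_trans H; rewrite ler_wpM2r// lerDl.
Qed.

Lemma uniform_cvg_at u p x : uniform_cvg u p -> u n x @[n --> \oo] --> p x.
Proof.
move=> up; apply/cvgrPdist_le => e e0; have [N HN] := up e e0.
by exists N => // n /= Nn; rewrite distrC; exact: HN.
Qed.

End UniformConvergence.

Lemma uniform_cvg_continuous (T : topologicalType) (R : realType)
    (u : nat -> T -> R) p :
  (forall n, continuous (u n)) -> uniform_cvg u p -> continuous p.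
Proof.
move=> cu up x; apply/cvgrPdist_le => e e0.
have e30 : 0 < e / 3 by lra.
have [N HN] := up _ e30.
have /cvgrPdist_le /(_ _ e30) := cu N x; apply: filterS => y.
have := HN N x (leqnn _); have := HN N y (leqnn _).
rewrite !ler_norml; lra.
Qed.

(** Log-convexity makes the ratios [r n] increase, submultiplicativity bounds them by [q 0], and [l]
    is their limit. Since [r n <= l], the normalized sequence decreases. It stays above 1 because [r
    m ^+ n.+1 * q m <= q (n + m).+1 <= q n * q m]; cancel [q m] and let [m] tend to infinity. The
    exponent is [n.+1] because [q n] will come from an (n+1)-st power. *)
Lemma logconvex_growth (R : realType) (q : nat -> R) :
  (forall n, 0 < q n) -> (forall n, q n.+1 ^+ 2 <= q n * q n.+2) ->
  (forall n m, q (n + m).+1 <= q n * q m) ->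
  exists l, [/\ 0 < l, forall n, 1 <= q n / l ^+ n.+1
    & nonincreasing_seq (fun n => q n / l ^+ n.+1)].
Proof.
move=> q0 qlog qsub; pose r n := q n.+1 / q n.
have r0 n : 0 < r n by rewrite divr_gt0.
have rnd : nondecreasing_seq r.
  apply/nondecreasing_seqP => n; rewrite /r ler_pdivlMr// mulrAC ler_pdivrMr//.
  by rewrite -expr2 mulrC.
have rq n : r n <= q 0%N by rewrite ler_pdivrMr// mulrC -[in leLHS](addn0 n).
have rcvg : cvgn r.
  by apply: nondecreasing_is_cvgn => //; exists (q 0%N) => _ [n _ <-].
have rl n : r n <= limn r by exact: nondecreasing_cvgn_le.
have l0 : 0 < limn r := lt_le_trans (r0 0%N) (rl 0%N).
exists (limn r); split => // [n|].
  rewrite ler_pdivlMr ?exprn_gt0// mul1r.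
  have cX : (r m ^+ n.+1) @[m --> \oo] --> limn r ^+ n.+1.
    exact: (cvg_comp _ _ rcvg (@exprn_continuous R n.+1 (limn r))).
  rewrite -(cvg_lim _ cX)//; apply: limr_le; first by apply/cvg_ex; eexists; exact: cX.
  apply: nearW => m.
  rewrite -(ler_pM2r (q0 m)); apply: le_trans (qsub n m).
  elim: n {cX} => [|n IH]; first by rewrite expr1 /r divfK ?gt_eqF.
  rewrite exprS -mulrA (le_trans (ler_wpM2l (ltW (r0 m)) IH))//.
  have -> : q (n.+1 + m).+1 = r (n + m).+1 * q (n + m).+1.
    by rewrite /r divfK ?gt_eqF// addSn.
  by rewrite ler_wpM2r ?(ltW (q0 _))// rnd// leqW// leq_addl.
apply/nonincreasing_seqP => n.
rewrite (exprS _ n.+1) ler_pdivrMr ?mulr_gt0 ?exprn_gt0//.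
rewrite (_ : q n / _ * _ = limn r * q n); first by rewrite -ler_pdivrMr//; exact: rl.
by rewrite mulrCA divfK// gt_eqF// exprn_gt0.
Qed.

(** * Convolution on a compact group *)

Section Convolution.
Variables (R : realType) (G : topologicalGroupType).
Local Notation bm := (@bounded_measurable _ (borel G) R).
Variables (mu : probability (borel G) R) (mu_haar : normalized_haar mu).
Hypothesis G2 : @second_countable G.
Hypothesis Gh : hausdorff_space G.
Hypothesis Gc : compact [set: G].
Implicit Types f g h : G -> R.
Local Notation "<< f , g >>" := (@dot _ (borel G) R mu f g).

Lemma bm_continuous f : continuous f -> bm f.
Proof.
move=> cf; split; first exact: continuous_borel_real.
have /compact_bounded[M [_ HM]] : compact (f @` setT).
  by apply: continuous_compact => //; exact: continuous_subspaceT.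
by exists (M + 1) => x; apply: HM; rewrite ?ltrDl//; exists x.
Qed.

(** Finitely many translates of [A] cover the compact group; if [A] were null, so would be the whole
    group. *)
Lemma open_haar_gt0 (A : set G) (g : G) : open A -> A g -> (0 < mu A)%E.
Proof.
move=> oA Ag; rewrite lt0e measure_ge0 andbT; apply/eqP => mA0.
have tr (x : G) : [set (x * y)%g | y in A] = (fun y => x^-1 * y)%g @^-1` A.
  apply/seteqP; split=> [_ [y Ay <-] /=|y /= Ay]; first by rewrite mulgA mulVg mul1g.
  by exists (x^-1 * y)%g => //; rewrite mulgA mulgV mul1g.
have otr (x : G) : open [set (x * y)%g | y in A].
  by rewrite tr; move/continuousP : (@mulgl_continuous G x^-1%g); apply.
have : compact [set: G] by [].
rewrite compact_cover => /(_ G setT (fun x : G => [set (x * y)%g | y in A])).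
move=> [x _|x _|D _ DT]; first exact: otr.
  by exists (x * g^-1)%g => //; exists g => //; rewrite -mulgA mulVg mulg1.
have := @content_sub_fsum _ _ _ mu G [set` finmap.enum_fset D] setT
  (fun x : G => [set (x * y)%g | y in A]) (finite_seq _).
rewrite fsbig1 => [|x _]; last first.
  by apply: etrans (mu_haar x _) mA0; exact: open_borel.
rewrite [X in (X <= _)%E]probability_setT => H.
suff : (1 <= 0 :> \bar R)%E by rewrite lee_fin ler10.
by apply: H => // x _; apply: open_borel; exact: otr.
Qed.

(** The form [dot] is only semidefinite on bounded functions; on continuous ones it is definite, as
    nonempty open sets have positive measure. *)
Lemma continuous_dot0 f : continuous f -> << f, f >> = 0 -> forall x, f x = 0.
Proof.
move=> cf f0 x; apply/eqP/negPn/negP => fx0.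
pose A := [set y | `|f x| / 2 < `|f y|].
have fx : 0 < `|f x| by rewrite normr_gt0.
have oA : open A.
  have cn : continuous (fun y => `|f y|) by move=> y; apply: cvg_norm; exact: cf.
  by move/continuousP : cn => /(_ _ (@open_gt _ (`|f x| / 2))).
have Ax : A x by rewrite /A/=; lra.
have mA : measurable (A : set (borel G)) by exact: open_borel.
have /= A0 := open_haar_gt0 oA Ax.
have : (`|f x| / 2) ^+ 2 * fine (mu A) <= << f, f >>.
  rewrite -(indic_integral mu) // -bm_integralZ; last exact: bm_indic.
  have bf := bm_continuous cf.
  apply: bm_integral_le => [||y].
  - by apply: bmZ; exact: bm_indic.
  - exact: bmM.
  rewrite indicE; have [Ay|Ay] := pselect (A y).
    rewrite mem_set// mulr1 -[leRHS]expr2 -[leRHS]real_normK ?num_real//.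
    by rewrite lerXn2r ?nnegrE ?divr_ge0// ltW.
  by rewrite memNset// mulr0 -expr2 sqr_ge0.
rewrite f0 leNgt mulr_gt0// ?exprn_gt0 ?divr_gt0//.
by rewrite fine_gt0// A0 ltey_eq fin_num_measure.
Qed.

Definition haar_conv f g : G -> R :=
  fun x => \int[mu]_z (f z * g ((z : G)^-1 * x)%g).
Local Notation conv := haar_conv.

Lemma bm_prod_conv f g : bm f -> bm g -> bounded_measurable
  (fun p : borel G * borel G => f p.2 * g ((p.2 : G)^-1 * (p.1 : G))%g).
Proof.
move=> bf bg.
have H : bounded_measurable
    (fun p : borel G * borel G => f p.1 * g ((p.1 : G)^-1 * (p.2 : G))%g).
  apply: bmM; first exact: (bm_comp measurable_fst).
  exact: (bm_comp (mulVg_borel G2)).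
exact: (bm_swap H).
Qed.

Lemma bm_conv f g : bm f -> bm g -> bm (conv f g).
Proof. by move=> bf bg; exact: (bm_fubini_bm mu (bm_prod_conv bf bg)). Qed.

Lemma bm_shift g (x : G) : bm g -> bm (fun z => g ((z : G)^-1 * x)%g).
Proof.
move=> bg; apply: (bm_invg (f := fun z : borel G => g ((z : G) * x)%g)).
exact: bm_mulgr.
Qed.

Lemma dot_shift g (x : G) : bm g ->
  << fun z => g ((z : G)^-1 * x)%g, fun z => g ((z : G)^-1 * x)%g >> = << g, g >>.
Proof.
move=> bg; rewrite /dot.
rewrite (haar_invg mu_haar G2 (f := fun z : borel G => g ((z : G) * x)%g * g ((z : G) * x)%g)).
  by rewrite (haar_mulr mu_haar G2 x (f := fun z => g z * g z))//; exact: bmM.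
by apply: bmM; exact: bm_mulgr.
Qed.

(** Turns L2 estimates on the factors into a uniform estimate; every passage from L2-Cauchy to
    uniformly Cauchy rests on it. *)
Lemma conv_bound f g x : bm f -> bm g ->
  `|conv f g x| <= Num.sqrt << f, f >> * Num.sqrt << g, g >>.
Proof.
move=> bf bg; rewrite -(dot_shift x bg).
by apply: cauchy_schwarz => //; exact: bm_shift.
Qed.

Lemma dot_conv_le f g : bm f -> bm g ->
  << conv f g, conv f g >> <= << f, f >> * << g, g >>.
Proof.
move=> bf bg; rewrite -[leRHS](bm_integral_cst mu).
apply: bm_integral_le; [by apply: bmM; exact: bm_conv|exact: bm_cst|move=> x].
rewrite -expr2 -(dot_shift x bg).
by apply: cauchy_schwarz_sq => //; exact: bm_shift.
Qed.

Lemma convBl f1 f2 g : bm f1 -> bm f2 -> bm g ->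
  conv (fun x => f1 x - f2 x) g = (fun x => conv f1 g x - conv f2 g x).
Proof.
by move=> ? ? ?; apply/funext => x; rewrite /haar_conv -dotBl//; exact: bm_shift.
Qed.

Lemma convBr f g1 g2 : bm f -> bm g1 -> bm g2 ->
  conv f (fun x => g1 x - g2 x) = (fun x => conv f g1 x - conv f g2 x).
Proof.
by move=> ? ? ?; apply/funext => x; rewrite /haar_conv -dotBr//; exact: bm_shift.
Qed.

Lemma convZl c f g : bm f -> bm g ->
  conv (fun x => c * f x) g = (fun x => c * conv f g x).
Proof.
by move=> ? ?; apply/funext => x; rewrite /haar_conv -dotZl//; exact: bm_shift.
Qed.

Lemma convZr c f g : bm f -> bm g ->
  conv f (fun x => c * g x) = (fun x => c * conv f g x).
Proof.
by move=> ? ?; apply/funext => x; rewrite /haar_conv -dotZr//; exact: bm_shift.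
Qed.

Lemma conv_mull f g (y x : G) : bm f -> bm g ->
  conv f g (y * x)%g = conv (fun z => f (y * z)%g) g x.
Proof.
move=> bf bg; rewrite /haar_conv -(haar_mull mu_haar y); last first.
  by apply: bmM => //; exact: bm_shift.
by apply: eq_Rintegral => z _; rewrite invgM -mulgA mulKg.
Qed.

Lemma haar_convA f g h : bm f -> bm g -> bm h ->
  conv (conv f g) h = conv f (conv g h).
Proof.
move=> bf bg bh; apply/funext => x.
have bF : bounded_measurable (fun p : borel G * borel G =>
    f p.2 * g ((p.2 : G)^-1 * (p.1 : G))%g * h ((p.1 : G)^-1 * x)%g).
  apply: bmM; first exact: bm_prod_conv.
  exact: (bm_comp measurable_fst (bm_shift x bh)).
transitivity (\int[mu]_z \int[mu]_w (f w * g ((w : G)^-1 * (z : G))%g * h ((z : G)^-1 * x)%g)).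
  apply: eq_Rintegral => z _.
  rewrite mulrC -bm_integralZ; last by apply: bmM => //; exact: bm_shift.
  by apply: eq_Rintegral => w _; rewrite mulrC.
rewrite (bm_fubini mu bF) /=.
apply: eq_Rintegral => w _; rewrite (conv_mull _ _ bg bh) -bm_integralZ.
  by apply: eq_Rintegral => z _; rewrite mulrA.
by apply: bmM; [exact: bm_mulgl|exact: bm_shift].
Qed.

(** Moving [x] amounts to translating [f]; since [g] is bounded, the change is controlled by the L1
    distance between two translates of [f]. *)
Lemma conv_continuous f g : bm f -> bm g -> continuous (conv f g).
Proof.
move=> bf bg x0; apply/cvgrPdist_lt => e e0.
have [_ [M gM]] := bg.
have M0 : 0 <= M by apply: le_trans (gM point).
have M1 : 0 < M + 1 by lra.
have tf := bm_tc mu_haar G2 Gh Gc bf (divr_gt0 e0 M1).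
have cx : (fun x : G => x0 * x^-1)%g @ x0 --> (1%g : G).
  rewrite -(mulgV x0); apply: (cvg_comp2 (cvg_cst x0) _ (@mulg_cvg G x0 x0^-1%g)).
  exact: invg_continuous.
have {}tf : \forall x \near x0, \int[mu]_y
    `|f ((x0 * x^-1)^-1 * (y : G))%g - f y| < e / (M + 1) by exact: (cx _ tf).
apply: filterS tf => x H.
rewrite -(mulg1 x) -(mulg1 x0) !conv_mull//.
set f1 := (fun z => f (x0 * z)%g); set f2 := (fun z => f (x * z)%g).
have bf1 : bm f1 by exact: bm_mulgl.
have bf2 : bm f2 by exact: bm_mulgl.
have bd : bm (fun z => f1 z - f2 z) by exact: bmB.
have -> : conv f1 g 1%g - conv f2 g 1%g = conv (fun z => f1 z - f2 z) g 1%g.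
  by rewrite convBl.
rewrite (le_lt_trans (bm_integral_norm mu _))//; first by apply: bmM => //; exact: bm_shift.
apply: (@le_lt_trans _ _ (\int[mu]_z (M * `|f1 z - f2 z|))).
  apply: bm_integral_le => [||z].
  - by apply: bm_norm; apply: bmM => //; exact: bm_shift.
  - by apply: bmZ; exact: bm_norm.
  - by rewrite normrM mulrC ler_wpM2r.
rewrite bm_integralZ; last exact: bm_norm.
have {H} : \int[mu]_z `|f1 z - f2 z| < e / (M + 1).
  (* Translating by [x0^-1] compares [f] with its translate by [x0 * x^-1], which is close to the
     unit. *)
  rewrite -(haar_mull mu_haar x0^-1%g) /=; last exact: bm_norm.
  apply: le_lt_trans H; rewrite le_eqVlt; apply/orP; left; apply/eqP.
  apply: eq_Rintegral => z _; rewrite distrC /f1 /f2 mulVKg invgM invgK.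
  by rewrite mulgA.
rewrite ltr_pdivlMr// mulrC => H; apply: le_lt_trans H.
by rewrite ler_wpM2r ?lerDl// Rintegral_ge0.
Qed.

Definition inversion_symmetric f := forall x : G, f x^-1%g = f x.
Local Notation sym := inversion_symmetric.

Lemma conv_sym f g x : bm f -> bm g -> sym f -> sym g ->
  conv f g x^-1%g = conv g f x.
Proof.
move=> bf bg sf sg; rewrite -[x^-1%g]mulg1 conv_mull//; apply: eq_Rintegral => z _.
by rewrite mulg1 sg mulrC -sf invgM invgK.
Qed.

Lemma haar_conv1 f g : sym g -> conv f g 1%g = << f, g >>.
Proof. by move=> sg; apply: eq_Rintegral => z _; rewrite mulg1 sg. Qed.

Lemma uniform_cvg_conv f u p : bm f -> (forall n, bm (u n)) -> bm p ->
  uniform_cvg u p -> uniform_cvg (fun n => conv f (u n)) (conv f p).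
Proof.
move=> bf bu bp up e e0.
have [_ [M fM]] := bf.
have M0 : 0 <= M by apply: le_trans (fM point).
have M1 : 0 < M + 1 by lra.
have [N HN] := up _ (divr_gt0 e0 M1); exists N => n x Nn.
have -> : conv f (u n) x - conv f p x = conv f (fun y => u n y - p y) x by rewrite convBr.
apply: bm_integral_bound => [|z].
  by apply: bmM => //; exact: (bm_shift x (bmB (bu n) bp)).
rewrite normrM; apply: le_trans (ler_pM _ _ (fM z) (HN n _ Nn)) _ => //.
by rewrite mulrA ler_pdivrMr// mulrC ler_wpM2l ?(ltW e0)// lerDl.
Qed.

End Convolution.

(** * The power method for a symmetric kernel *)

Section SpectralProjection.
Variables (R : realType) (G : topologicalGroupType).
Local Notation bm := (@bounded_measurable _ (borel G) R).
Variables (mu : probability (borel G) R) (mu_haar : normalized_haar mu).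
Hypothesis G2 : @second_countable G.
Hypothesis Gh : hausdorff_space G.
Hypothesis Gc : compact [set: G].
Local Notation "<< f , g >>" := (@dot _ (borel G) R mu f g).
Local Notation conv := (haar_conv mu).

(** Index [n] stands for [n.+1] factors: convolution need not have a unit among functions, so the
    powers start at [K]. This explains the successors in the exponent laws below. *)
Fixpoint conv_pow (K : G -> R) n := if n is m.+1 then conv K (conv_pow K m) else K.

Variable K : G -> R.
Hypotheses (cK : continuous K) (sK : inversion_symmetric K) (K1 : K 1%g != 0).
Local Notation P := (conv_pow K).

Let bK : bm K := bm_continuous Gc cK.

Lemma bm_conv_pow n : bm (P n).
Proof. by elim: n => [//|n IH]; exact: bm_conv. Qed.
Local Notation bP := bm_conv_pow.

Lemma conv_pow_continuous n : continuous (P n).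
Proof. by case: n => [//|n]; apply: conv_continuous => //; exact: bP. Qed.

Lemma conv_powD m n : conv (P m) (P n) = P (m + n).+1.
Proof.
elim: m => [//|m IH]; rewrite [P m.+1]/= haar_convA ?IH//; exact: bP.
Qed.

Lemma conv_pow_sym n : inversion_symmetric (P n).
Proof.
elim: n => [//|n IH] x; rewrite [P n.+1]/= conv_sym//; last exact: bP.
by rewrite -[X in conv _ X]/(P 0) conv_powD addn0.
Qed.

Lemma dot_conv_pow m n : << P m, P n >> = P (m + n).+1 1%g.
Proof. by rewrite -conv_powD haar_conv1//; exact: conv_pow_sym. Qed.

Let q n := << P n, P n >>.

Let qE n : q n = P (n + n).+1 1%g. Proof. exact: dot_conv_pow. Qed.

Let q_log n : q n.+1 ^+ 2 <= q n * q n.+2.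
Proof.
(* [q n.+1] is also the inner product of [P n] and [P n.+2]. *)
rewrite {1}qE addSnnS -dot_conv_pow.
by apply: cauchy_schwarz_sq; exact: bP.
Qed.

Let q_gt0 n : 0 < q n.
Proof.
(* Log-convexity propagates positivity only from two consecutive terms; [q 1] is positive because
   [P 1] takes the value [q 0] at the unit. *)
suff [] : 0 < q n /\ 0 < q n.+1 by [].
elim: n => [|n [_ IH]].
  have q0 : 0 < q 0%N.
    rewrite lt_def dot_ge0 andbT; apply: contra K1 => /eqP q0.
    by rewrite (continuous_dot0 mu_haar Gc cK q0).
  split => //; rewrite lt_def dot_ge0 andbT; apply/eqP => q1.
  have := continuous_dot0 mu_haar Gc (@conv_pow_continuous 1) q1 1%g.
  by move/eqP; rewrite -[1%N]/(0 + 0).+1 -qE gt_eqF.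
split => //; rewrite lt_def dot_ge0 andbT; apply/eqP => q2.
by have := q_log n; rewrite q2 mulr0 leNgt exprn_gt0.
Qed.

Let q_sub n m : q (n + m).+1 <= q n * q m.
Proof. by rewrite /q -conv_powD; apply: dot_conv_le => //; exact: bP. Qed.

(** [g n] is the (n+1)-st convolution power of [K * K / l]. Since [<< g n, g m >> = b (n + m).+1]
    and [b] converges, [g] is L2-Cauchy; one more factor [K * K] makes it uniformly Cauchy. The
    limit is nonzero because [g n] takes at the unit the value [b n >= 1]. *)
Lemma spectral_projection : exists l p,
  [/\ l != 0, continuous p, inversion_symmetric p & [/\
      conv p p = p, 1 <= p 1%g & conv (conv K K) p = (fun x => l * p x)]].
Proof.
have [l [l0 b1 bdec]] := logconvex_growth q_gt0 q_log q_sub.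
set b := (fun n => q n / l ^+ n.+1) in bdec.
pose g n x := (l ^+ n.+1)^-1 * P (n + n).+1 x.
have bg n : bm (g n) by apply: bmZ; exact: bP.
have cg n : continuous (g n).
  by move=> x; apply: cvgM; [exact: cvg_cst|exact: conv_pow_continuous].
have sg n : inversion_symmetric (g n) by move=> x; rewrite /g conv_pow_sym.
have gg n m : conv (g n) (g m) = g (n + m).+1.
  rewrite /g convZl//; [|exact: bP|by apply: bmZ; exact: bP].
  rewrite convZr//; [|exact: bP..].
  rewrite conv_powD; apply/funext => x.
  rewrite /= mulrA -invfM -exprD.
  have -> : (n.+1 + m.+1 = (n + m).+2)%N by lia.
  by have -> : (n + n + (m + m).+1 = n + m + (n + m).+1)%N by lia.
have dg n m : << g n, g m >> = b (n + m).+1.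
  rewrite -haar_conv1// gg /g /b qE mulrC; congr (_ / _ ^+ _).
have Kg n : conv (P 1) (g n) = (fun x => l * g n.+1 x).
  rewrite /g convZr//; [|exact: bP..].
  rewrite conv_powD; apply/funext => x.
  have -> : (l ^+ n.+1)^-1 = l * (l ^+ n.+2)^-1.
    by rewrite (exprS _ n.+1) invfM mulrA divff ?gt_eqF// mul1r.
  rewrite -mulrA.
  by have -> : (1 + (n + n).+1 = n.+1 + n.+1)%N by lia.
have bcvg : cvgn b.
  apply: nonincreasing_is_cvgn => //.
  by exists 1 => _ [n _ <-]; exact: b1.
have [p gp] : exists p, uniform_cvg (fun n => g n.+1) p.
  apply: uniform_cauchy_cvg => e e0.
  pose s := Num.sqrt (q 1%N).
  have s0 : 0 <= s by exact: sqrtr_ge0.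
  have t0 : 0 < e * l / (s + 1) by rewrite divr_gt0 ?mulr_gt0//; lra.
  (* The squared L2 distance is [b - 2 b + b] at three indices, hence at most [4 * h] once each is
     within [h] of the limit. Here [s] is the norm of [P 1], and [s + 1] keeps the denominator
     positive. *)
  pose h := (e * l / (s + 1)) ^+ 2 / 4.
  have h0 : 0 < h by rewrite divr_gt0 ?exprn_gt0.
  move/cvgrPdist_le : bcvg => /(_ h h0) [N _ HN].
  exists N => n m x Nn Nm.
  have -> : g n.+1 x - g m.+1 x = l^-1 * conv (P 1) (fun y => g n y - g m y) x.
    rewrite convBr//; last exact: bP.
    by rewrite !Kg -mulrBr mulKf// gt_eqF.
  have li0 : 0 <= l^-1 by rewrite invr_ge0 ltW.
  rewrite normrM (ger0_norm li0) [leLHS]mulrC ler_pdivrMr//.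
  apply: le_trans (conv_bound mu_haar G2 _ (bP 1) (bmB (bg n) (bg m))) _.
  rewrite dot_sqB// !dg -/(q 1) -/s.
  have Hb : b (n + n).+1 - 2 * b (n + m).+1 + b (m + m).+1 <= (e * l / (s + 1)) ^+ 2.
    have -> : (e * l / (s + 1)) ^+ 2 = 4 * h by rewrite /h mulrCA divff ?mulr1// pnatr_eq0.
    have {}HN i : (N <= i)%N -> `|limn b - b i| <= h by exact: HN.
    have : `|limn b - b (n + n).+1| <= h by apply: HN; lia.
    have : `|limn b - b (n + m).+1| <= h by apply: HN; lia.
    have : `|limn b - b (m + m).+1| <= h by apply: HN; lia.
    rewrite !ler_norml; lra.
  have := ler_wsqrtr Hb; rewrite sqrtr_sqr (ger0_norm (ltW t0)) => H.
  apply: le_trans (ler_wpM2l s0 H) _.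
  rewrite mulrCA ler_piMr ?mulr_ge0 ?(ltW e0) ?(ltW l0)// ler_pdivrMr; lra.
have {}gp : uniform_cvg g p.
  move=> e e0; have [N HN] := gp e e0; exists N.+1 => -[//|n] x Nn; exact: HN.
have cp : continuous p by exact: uniform_cvg_continuous gp.
have bp : bm p by exact: bm_continuous.
have sp : inversion_symmetric p.
  move=> x; have H1 := @uniform_cvg_at _ _ g p x^-1%g gp; have H2 := @uniform_cvg_at _ _ g p x gp.
  have E : (fun n => g n x^-1%g) = g ^~ x by apply/funext => n; exact: sg.
  by rewrite E in H1; rewrite -(cvg_lim _ H1)// -(cvg_lim _ H2).
(* Convolving the sequence by [g m] only shifts it, so the limit is unchanged. *)
have gmp m : conv (g m) p = p.
  apply: (@uniform_cvg_unique _ _ (fun n => conv (g m) (g n))).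
    exact: uniform_cvg_conv.
  under eq_fun do rewrite gg addnC -addnS.
  exact: uniform_cvg_shift.
have pgm m : conv p (g m) = p.
  by apply/funext => x; rewrite -(invgK x) conv_sym// gmp invgK sp.
exists l, p; split => //; first by rewrite gt_eqF.
split.
- apply: (@uniform_cvg_unique _ _ (fun n => conv p (g n))).
    exact: uniform_cvg_conv.
  by under eq_fun do rewrite pgm; exact: uniform_cvg_cst.
- have := @uniform_cvg_at _ _ g p 1%g gp => /[dup] gp1 /cvg_lim <- //.
  apply: limr_ge; first by apply/cvg_ex; exists (p 1%g).
  by apply: nearW => n; rewrite /g -qE mulrC.
- apply: (@uniform_cvg_unique _ _ (fun n => conv (P 1) (g n))).
    by apply: uniform_cvg_conv => //; exact: bP.
  under eq_fun do rewrite Kg.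
  apply: uniform_cvgZ; under eq_fun do rewrite -addn1.
  exact: uniform_cvg_shift.
Qed.

End SpectralProjection.

(** * The Peter-Weyl theorem *)

Section Eigenspace.
Variables (R : realType) (G : topologicalGroupType).
Local Notation bm := (@bounded_measurable _ (borel G) R).
Variables (mu : probability (borel G) R) (mu_haar : normalized_haar mu).
Hypothesis G2 : @second_countable G.
Hypothesis Gh : hausdorff_space G.
Hypothesis Gc : compact [set: G].
Local Notation "<< f , g >>" := (@dot _ (borel G) R mu f g).
Local Notation conv := (haar_conv mu).

(** Only the first [k] terms count; indexing by [nat] lets a family be extended without changing its
    type. *)
Definition orthonormal_family (k : nat) (F : nat -> G -> R) :=
  forall i j, (i < k)%N -> (j < k)%N -> << F i, F j >> = (i == j)%:R.

Lemma dot_orthonormal_sum k F (c : nat -> R) j : (forall i, bm (F i)) ->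
  orthonormal_family k F -> (j < k)%N ->
  << fun x => \sum_(i < k) c i * F i x, F j >> = c j.
Proof.
move=> bF oF jk; rewrite (dot_suml _ _
  (F := fun i : 'I_k => fun x : borel G => c i * F i x))//; last first.
  by move=> i; exact: bmZ.
rewrite (bigD1 (Ordinal jk))//= big1 => [|i ij].
  by rewrite addr0 dotZl// oF// eqxx mulr1.
by rewrite dotZl// oF// -[i == j :> nat]/(i == Ordinal jk) (negbTE ij) mulr0.
Qed.

(** The residual of [h] after projection to the family has nonnegative squared norm. *)
Lemma bessel k F h : (forall i, bm (F i)) -> orthonormal_family k F -> bm h ->
  \sum_(i < k) << h, F i >> ^+ 2 <= << h, h >>.
Proof.
move=> bF oF bh; pose s x := \sum_(i < k) << h, F i >> * F i x.
have bs : bm s by apply: bm_sum => i; exact: bmZ.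
have hs : << h, s >> = \sum_(i < k) << h, F i >> ^+ 2.
  rewrite dotC (dot_suml _ _ (F := fun i : 'I_k => fun x : borel G => << h, F i >> * F i x))//.
    by apply: eq_bigr => i _; rewrite dotZl// dotC expr2.
  by move=> i; exact: bmZ.
have ss : << s, s >> = \sum_(i < k) << h, F i >> ^+ 2.
  rewrite {1}/s (dot_suml _ _ (F := fun i : 'I_k => fun x : borel G => << h, F i >> * F i x))//.
    apply: eq_bigr => i _; rewrite dotZl// (dotC mu (F i) s) /s.
    have /= -> := dot_orthonormal_sum (fun i => << h, F i >>) bF oF (ltn_ord i).
    by rewrite expr2.
  by move=> i; exact: bmZ.
have := dot_ge0 mu (fun x => h x - s x).
rewrite dot_sqB// hs ss; lra.
Qed.

Variable p : G -> R.
Hypotheses (cp : continuous p) (sp : inversion_symmetric p) (pp : conv p p = p).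

Let bp : bm p := bm_continuous Gc cp.

(** The range of right convolution by the idempotent [p]. Convolving on the right commutes with left
    translation, so this space is stable under left translation. *)
Definition eigenspace_fun (f : G -> R) := continuous f /\ conv f p = f.
Local Notation V := eigenspace_fun.

Lemma eigenspace_bm f : V f -> bm f.
Proof. by case=> cf _; exact: bm_continuous. Qed.

Lemma eigenspaceD f g : V f -> V g -> V (fun x => f x + g x).
Proof.
move=> [cf fp] [cg gp]; split; first by move=> x; apply: cvgD; [exact: cf|exact: cg].
have bf := bm_continuous Gc cf; have bg := bm_continuous Gc cg.
rewrite -[in RHS]fp -[in RHS]gp; apply/funext => x.
by rewrite /haar_conv -(dotDl _ bf bg (bm_shift x bp)).
Qed.

Lemma eigenspaceZ c f : V f -> V (fun x => c * f x).
Proof.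
move=> [cf fp]; split; first by move=> x; apply: cvgM; [exact: cvg_cst|exact: cf].
by rewrite convZl ?fp//; exact: bm_continuous.
Qed.

Lemma eigenspace_sum (I : Type) (r : seq I) (F : I -> G -> R) f0 : V f0 ->
  (forall i, V (F i)) -> V (fun x => \sum_(i <- r) F i x).
Proof.
move=> V0 VF; elim: r => [|i r IH].
  by under eq_fun => x do [rewrite big_nil -(mul0r (f0 x))]; exact: eigenspaceZ.
by under eq_fun do rewrite big_cons; exact: eigenspaceD.
Qed.

Lemma eigenspace_translate (y : G) f : V f -> V (fun x => f (y^-1 * x)%g).
Proof.
move=> Vf; have bf := eigenspace_bm Vf; have [cf fp] := Vf; split.
  move=> x; apply: (continuous_comp (f := fun x => (y^-1 * x)%g)); last exact: cf.
  exact: mulgl_continuous.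
by apply/funext => x; rewrite -(conv_mull mu_haar _ _ bf bp) fp.
Qed.

(** Since [F i = F i * p], the number [F i x] is the inner product of [F i] with a reflected
    translate of [p]. Bessel bounds the sum of the [F i x ^+ 2] by the squared norm of [p] at each
    [x]; integrate over [x]. *)
Lemma orthonormal_eigenspace_bound k F : (forall i, V (F i)) ->
  orthonormal_family k F -> k%:R <= << p, p >>.
Proof.
move=> VF oF; have bF i := eigenspace_bm (VF i).
have -> : k%:R = \int[mu]_x \sum_(i < k) (F i x * F i x).
  rewrite bm_integral_sum => [|i]; last exact: bmM.
  rewrite (eq_bigr (fun=> 1)) ?sumr_const ?card_ord// => i _.
  by have := oF i i (ltn_ord i) (ltn_ord i); rewrite eqxx.
rewrite -[leRHS](bm_integral_cst mu); apply: bm_integral_le => [||x].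
- by apply: bm_sum => i; exact: bmM.
- exact: bm_cst.
rewrite -(dot_shift mu_haar G2 x bp).
apply: le_trans (bessel bF oF (bm_shift x bp)).
apply: ler_sum => i _; rewrite -expr2 -{1}(VF i).2.
by rewrite /haar_conv dotC.
Qed.

(** The bound on cardinality yields a maximal orthonormal family; a nonzero residual of some [f],
    once normalized, would extend it. *)
Lemma eigenspace_basis : exists k F, [/\ forall i, V (F i), orthonormal_family k F
  & forall f, V f -> f = (fun x => \sum_(i < k) << f, F i >> * F i x)].
Proof.
pose Pk k := exists F, (forall i, V (F i)) /\ orthonormal_family k F.
have [k [[F [VF oF]] kmax]] : exists k, Pk k /\ ~ Pk k.+1.
  apply: contrapT => /forallNP H.
  have {}H k : Pk k.
    elim: k => [|k IH]; first by exists (fun=> p).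
    by apply: contrapT => Nk; exact: (H k).
  have [F [VF oF]] := H (Num.bound << p, p >>).
  have := orthonormal_eigenspace_bound VF oF.
  by rewrite leNgt archi_boundP// dot_ge0.
exists k, F; split => // f Vf; have bF i := eigenspace_bm (VF i).
pose s x := \sum_(i < k) << f, F i >> * F i x.
have Vs : V s by apply: (eigenspace_sum _ Vf) => i; exact: eigenspaceZ.
have [Vr rE] : V (fun x => f x - s x) /\ forall x, f x - s x = f x + -1 * s x.
  split; last by move=> x; rewrite mulN1r.
  under eq_fun do rewrite -mulN1r; exact/eigenspaceD/eigenspaceZ.
set r := (fun x => f x - s x) in Vr.
have br := eigenspace_bm Vr; have bs := eigenspace_bm Vs; have bf := eigenspace_bm Vf.
have rF j : (j < k)%N -> << r, F j >> = 0.
  move=> jk; rewrite dotBl//.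
  have /= -> := dot_orthonormal_sum (fun i => << f, F i >>) bF oF jk.
  by rewrite subrr.
have [rr|rr] := eqVneq << r, r >> 0.
  apply/funext => x; apply/eqP; rewrite -subr_eq0; apply/eqP.
  exact: (continuous_dot0 mu_haar Gc Vr.1 rr).
exfalso; apply: kmax.
pose t := Num.sqrt << r, r >>.
have t2 : t ^+ 2 = << r, r >> by rewrite sqr_sqrtr// dot_ge0.
have t0 : t != 0 by apply: contra rr; rewrite -t2 => /eqP ->; rewrite expr0n.
exists (fun i => if i == k then (fun x => t^-1 * r x) else F i); split.
  by move=> i; case: ifP => _ //; exact: eigenspaceZ.
move=> i j; rewrite !ltnS => ik jk.
have [ik'|iNk] := eqVneq i k; have [jk'|jNk] := eqVneq j k.
- rewrite ik' jk' eqxx dotZl ?dotZr//; last exact: bmZ.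
  by rewrite -t2 expr2 mulKf ?mulVf.
- by rewrite ik' eq_sym (negbTE jNk) dotZl// rF ?ltn_neqAle ?jNk// mulr0.
- by rewrite jk' (negbTE iNk) dotC dotZl// rF ?ltn_neqAle ?iNk// mulr0.
- by rewrite oF// ltn_neqAle ?iNk ?jNk.
Qed.

(* Left translation acts on the finite-dimensional eigenspace, and p is a
   combination of the coefficients of that representation. *)
Lemma idempotent_coefficients : exists k (rho : G -> 'M[R]_k) (c : 'M[R]_k),
  [/\ forall x y, rho (x * y)%g = rho x *m rho y,
      forall x, rho x *m (rho x)^T = 1%:M,
      forall i j, continuous (fun x => rho x i j)
    & forall x, p x = \sum_i \sum_j c i j * rho x i j].
Proof.
have [k [F [VF oF FE]]] := eigenspace_basis.
have bF i := eigenspace_bm (VF i).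
pose L (y : G) (f : G -> R) (x : G) := f (y^-1 * x)%g.
have VL y f : V f -> V (L y f) by exact: eigenspace_translate.
have bL y i : bm (L y (F i)) := eigenspace_bm (VL y _ (VF i)).
pose rho (y : G) : 'M[R]_k := \matrix_(i, j) << L y (F j), F i >>.
have LF y j x : L y (F j) x = \sum_(i < k) << L y (F j), F i >> * F i x.
  by rewrite [in LHS](FE _ (VL y _ (VF j))).
have rhoM x y : rho (x * y)%g = rho x *m rho y.
  apply/matrixP => i j; rewrite !mxE.
  have -> : L (x * y)%g (F j) = fun z => \sum_(l < k) << L y (F j), F l >> * L x (F l) z.
    by apply/funext => z; rewrite {1}/L invgM -mulgA -[LHS]/(L y (F j) (x^-1 * z)%g) LF.
  rewrite (dot_suml _ _ (F := fun l : 'I_k => fun z : borel G =>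
    << L y (F j), F l >> * L x (F l) z))//.
    by apply: eq_bigr => l _; rewrite dotZl// !mxE mulrC.
  by move=> l; exact: bmZ.
have rhoO y : (rho y)^T *m rho y = 1%:M.
  apply/matrixP => i j; rewrite !mxE.
  have := oF i j (ltn_ord i) (ltn_ord j).
  rewrite -val_eqE /= => <-.
  have -> : << F i, F j >> = << L y (F i), L y (F j) >>.
    by rewrite /dot -(haar_mull mu_haar y^-1%g)//; exact: bmM.
  rewrite (_ : L y (F i) = fun x => \sum_(l < k) << L y (F i), F l >> * F l x); last first.
    by apply/funext => x; exact: LF.
  rewrite (dot_suml _ _ (F := fun l : 'I_k => fun z : borel G => << L y (F i), F l >> * F l z))//.
    apply: eq_bigr => l _; by rewrite dotZl// !mxE (dotC mu (F l) (L y _)).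
  by move=> l; exact: bmZ.
(* By symmetry [p y = p y^-1]; expand [p] in the [F j], read [F j y^-1] as the translate of [F j] by
   [y] at the unit, and expand that translate through [rho y]. *)
exists k, rho, (\matrix_(i, j) (<< p, F j >> * F i 1%g)); split => //.
- by move=> x; apply: mulmx1C.
- move=> i j.
  have bi : bm (fun x : borel G => F j (x : G)^-1%g) by exact: bm_invg.
  have -> : (fun x => rho x i j) = conv (F i) (fun x => F j x^-1%g).
    apply/funext => x; rewrite mxE dotC; apply: eq_Rintegral => z _.
    by rewrite invgM invgK.
  exact: conv_continuous.
- move=> y; rewrite -(sp y) -[y^-1%g]mulg1.
  have Vp : V p by [].
  rewrite [in LHS](FE p Vp).
  under eq_bigr => j _.
    rewrite -[F j _]/(L y (F j) 1%g) LF mulr_sumr.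
    over.
  rewrite exchange_big /=; apply: eq_bigr => i _; apply: eq_bigr => j _.
  by rewrite !mxE; ring.
Qed.

End Eigenspace.

Lemma sqrt_inv_small (R : realType) (c e : R) : 0 <= c -> 0 < e ->
  exists N, forall n, (N <= n)%N -> Num.sqrt (c * n.+1%:R^-1) <= e.
Proof.
move=> c0 e0; have e2 : 0 < e ^+ 2 by rewrite exprn_gt0.
have ce : 0 <= c / e ^+ 2 by rewrite divr_ge0// ltW.
exists (Num.bound (c / e ^+ 2)) => n Nn.
rewrite -[leRHS]ger0_norm ?(ltW e0)// -sqrtr_sqr ler_wsqrtr//.
rewrite ler_pdivrMr// mulrC -ler_pdivrMr// (le_trans (ltW (archi_boundP ce)))//.
by rewrite ler_nat leqW.
Qed.

(** * Density of real matrix coefficients *)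

Section RealDensity.
Variables (R : realType) (G : topologicalGroupType).
Local Notation bm := (@bounded_measurable _ (borel G) R).
Variables (mu : probability (borel G) R) (mu_haar : normalized_haar mu).
Hypothesis G2 : @second_countable G.
Hypothesis Gh : hausdorff_space G.
Hypothesis Gc : compact [set: G].
Local Notation "<< f , g >>" := (@dot _ (borel G) R mu f g).
Local Notation conv := (haar_conv mu).

(** Kept abstract so that the argument stays real; it will be instantiated with the real functions
    in the complex span of the coefficient functions. *)
Variable N : set (G -> R).
Hypotheses (N_bm : forall f, N f -> bm f) (N0 : N (fun=> 0))
  (ND : forall f g, N f -> N g -> N (fun x => f x + g x))
  (NZ : forall c f, N f -> N (fun x => c * f x))
  (N_right : forall g f, N f -> N (fun x => f (x * g)%g))
  (N_rep : forall k (rho : G -> 'M[R]_k),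
     (forall x y, rho (x * y)%g = rho x *m rho y) ->
     (forall x, rho x *m (rho x)^T = 1%:M) ->
     (forall i j, continuous (fun x => rho x i j)) ->
     forall i j, N (fun x => rho x i j)).

Let N_sum (I : Type) (r : seq I) (F : I -> G -> R) :
  (forall i, N (F i)) -> N (fun x => \sum_(i <- r) F i x).
Proof.
move=> NF; elim: r => [|i r IH].
  by under eq_fun => x do rewrite big_nil.
by under eq_fun do rewrite big_cons; exact: ND.
Qed.

(* If f were at positive distance from N, the autocorrelations of a minimizing
   sequence of residuals would converge uniformly to a nonzero symmetric kernel
   K with K * p = 0 for all p in N; but the spectral projections of K * K are in N. *)
Lemma real_density f e : bm f -> 0 < e ->
  exists2 m, N m & << fun x => f x - m x, fun x => f x - m x >> < e.
Proof.
move=> bf e0; apply: contrapT => Hne.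
have far m : N m -> e <= << fun x => f x - m x, fun x => f x - m x >>.
  by move=> Nm; rewrite leNgt; apply/negP => H; apply: Hne; exists m.
pose D := [set << fun x => f x - m x, fun x => f x - m x >> | m in N].
have hD : has_inf D.
  by split; [eexists; exists (fun=> 0) => // | exists e => _ [m Nm <-]; exact: far].
pose d := inf D.
have d0 : 0 < d.
  apply: lt_le_trans e0 _; apply: lb_le_inf; first by case: hD.
  by move=> _ [m Nm <-]; exact: far.
have dN m : N m -> d <= << fun x => f x - m x, fun x => f x - m x >>.
  by move=> Nm; apply: ge_inf; [case: hD|exists m].
have [m mP] : exists m : nat -> G -> R, forall n, N (m n) /\
    << fun x => f x - m n x, fun x => f x - m n x >> < d + n.+1%:R^-1.
  suff /choice[m mP] : forall n : nat, exists m, N m /\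
    << fun x => f x - m x, fun x => f x - m x >> < d + n.+1%:R^-1 by exists m.
  move=> n; have n0 : 0 < n.+1%:R^-1 :> R by rewrite invr_gt0.
  have [_ [m Nm <-] H] := inf_adherent n0 hD.
  by exists m.
pose r n x := f x - m n x.
have br n : bm (r n) by apply: bmB => //; apply: N_bm; exact: (mP n).1.
have rle n : << r n, r n >> <= d + n.+1%:R^-1 by exact/ltW/(mP n).2.
have rd1 n : << r n, r n >> <= d + 1.
  by apply: le_trans (rle n) _; rewrite lerD2l invf_le1// ler1n.
have rN n h t : N h -> d <= << r n, r n >> - 2 * t * << r n, h >> + t ^+ 2 * << h, h >>.
  move=> Nh; have bh := N_bm Nh.
  have := dN _ (ND (mP n).1 (NZ t Nh)).
  rewrite (_ : (fun x => _) = (fun x => r n x - t * h x)); last first.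
    by apply/funext => x; rewrite opprD addrA.
  rewrite dot_sqB//; last exact: bmZ.
  by rewrite dotZl ?dotZr//; [congr (_ <= _); ring|exact: bmZ].
have rort n h : N h -> << r n, h >> ^+ 2 <= n.+1%:R^-1 * << h, h >>.
  move=> Nh; have bh := N_bm Nh; have [h0|h0] := eqVneq << h, h >> 0.
    by have := cauchy_schwarz_sq mu (br n) bh; rewrite h0 !mulr0.
  have hp : 0 < << h, h >> by rewrite lt_def h0 dot_ge0.
  (* The optimal multiple of [h]: it could lower the squared norm of [r n] by at most [n.+1%:R^-1],
     so [r n] is almost orthogonal to [N]. *)
  have := rN n h (<< r n, h >> / << h, h >>) Nh.
  rewrite (_ : _ - _ + _ = << r n, r n >> - << r n, h >> ^+ 2 / << h, h >>); last by field.
  rewrite lerBrDl -lerBrDr => H.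
  rewrite -ler_pdivrMr//; apply: le_trans H _.
  by rewrite lerBlDl.
(* The parallelogram law: the midpoint of [m n] and [m k] is in [N], so the midpoint of the
   residuals has squared norm at least [d]. *)
have rB n k : << fun x => r n x - r k x, fun x => r n x - r k x >>
    <= 2 * n.+1%:R^-1 + 2 * k.+1%:R^-1.
  have := dN _ (NZ 2^-1 (ND (mP n).1 (mP k).1)).
  rewrite (_ : (fun x => _) = (fun x => 2^-1 * r n x - (- 2^-1) * r k x)); last first.
    by apply/funext => x; rewrite /r; field.
  rewrite (dot_sqB mu (br n) (br k)) (dot_sqB mu (bmZ _ (br n)) (bmZ _ (br k))).
  rewrite !dotZl ?dotZr//; [|exact: bmZ..].
  have := rle n; have := rle k.
  move: (n.+1%:R^-1) (k.+1%:R^-1) => a b; lra.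
pose ri n x := r n x^-1%g.
have bri n : bm (ri n) by exact: bm_invg.
have dri h : bm h -> << fun x => h (x : G)^-1%g, fun x => h (x : G)^-1%g >> = << h, h >>.
  by move=> bh; rewrite /dot (haar_invg mu_haar G2 (f := fun x => h x * h x))//; exact: bmM.
pose K n := conv (r n) (ri n).
have cK n : continuous (K n) by exact: conv_continuous.
have bK n : bm (K n) by exact: bm_conv.
have sK n : inversion_symmetric (K n).
  move=> x; rewrite -[x^-1%g]mulg1 /K conv_mull//.
  apply: eq_Rintegral => z _.
  by rewrite /ri mulg1 invgK mulrC invgM invgK.
have K1 n : K n 1%g = << r n, r n >>.
  by apply: eq_Rintegral => z _; rewrite /ri mulg1 invgK.
pose C := Num.sqrt (d + 1).
have C0 : 0 < C by rewrite sqrtr_gt0; lra.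
have [Kl KKl] : exists Kl, uniform_cvg K Kl.
  apply: uniform_cauchy_cvg => e' e'0.
  have e2 : 0 < e' / (2 * C) by rewrite divr_gt0// mulr_gt0.
  have [M HM] := sqrt_inv_small (ler0n R 4) e2.
  exists M => n k x Mn Mk.
  have -> : K n x - K k x = conv (fun y => r n y - r k y) (ri n) x +
      conv (r k) (fun y => ri n y - ri k y) x.
    by rewrite convBl// convBr// /K; ring.
  apply: le_trans (ler_normD _ _) _.
  have H : Num.sqrt << fun x => r n x - r k x, fun x => r n x - r k x >> <= e' / (2 * C).
    apply: le_trans (HM M (leqnn _)); apply: ler_wsqrtr; apply: le_trans (rB n k) _.
    have : n.+1%:R^-1 <= M.+1%:R^-1 :> R by rewrite lef_pV2 ?posrE// ler_nat.
    have : k.+1%:R^-1 <= M.+1%:R^-1 :> R by rewrite lef_pV2 ?posrE// ler_nat.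
    move: (n.+1%:R^-1) (k.+1%:R^-1) (M.+1%:R^-1) => a b t; lra.
  have Cr j : Num.sqrt << r j, r j >> <= C by apply: ler_wsqrtr.
  have H1 := conv_bound mu_haar G2 x (bmB (br n) (br k)) (bri n).
  have H2 := conv_bound mu_haar G2 x (br k) (bmB (bri n) (bri k)).
  rewrite (dri _ (br n)) in H1; rewrite (dri _ (bmB (br n) (br k))) in H2.
  apply: le_trans (lerD H1 H2) _.
  apply: (@le_trans _ _ (e' / (2 * C) * C + C * (e' / (2 * C)))).
    by apply: lerD; apply: ler_pM; rewrite ?sqrtr_ge0.
  rewrite le_eqVlt; apply/orP; left; apply/eqP; field.
  by rewrite gt_eqF.
have cKl : continuous Kl by exact: uniform_cvg_continuous KKl.
have bKl : bm Kl by exact: bm_continuous.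
have sKl : inversion_symmetric Kl.
  move=> x; have H1 := @uniform_cvg_at _ _ K Kl x^-1%g KKl.
  have H2 := @uniform_cvg_at _ _ K Kl x KKl.
  have E : (fun n => K n x^-1%g) = K ^~ x by apply/funext => n; exact: sK.
  by rewrite E in H1; rewrite -(cvg_lim _ H1)// -(cvg_lim _ H2).
have Kl1 : Kl 1%g != 0.
  rewrite gt_eqF//; apply: lt_le_trans d0 _.
  have H := @uniform_cvg_at _ _ K Kl 1%g KKl.
  rewrite -(cvg_lim _ H)//; apply: limr_ge; first by apply/cvg_ex; exists (Kl 1%g).
  apply: nearW => n; rewrite K1; exact: dN (mP n).1.
have [l [p [l0 cp sp [pp p1 Kp]]]] := spectral_projection mu_haar G2 Gh Gc cKl sKl Kl1.
have [k [rho [c [rM rO rc pE]]]] := idempotent_coefficients mu_haar G2 Gh Gc cp sp pp.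
have Np : N p.
  rewrite (funext pE); do 2 apply: N_sum => ?; apply: NZ; exact: N_rep.
have bp := N_bm Np.
(* The convolution at [y] is the inner product of [r n] with a right translate of [p], which is
   again in [N]. *)
have rip n y : conv (ri n) p y ^+ 2 <= n.+1%:R^-1 * << p, p >>.
  have := rort n _ (N_right y Np).
  have -> : << fun x => p (x * y)%g, fun x => p (x * y)%g >> = << p, p >>.
    by rewrite /dot (haar_mulr mu_haar G2 y (f := fun x => p x * p x))//; exact: bmM.
  congr (_ ^+ 2 <= _).
  rewrite /dot -(haar_invg mu_haar G2 (f := fun z => r n z * p ((z : G) * y)%g)) //.
  by apply: bmM => //; exact: bm_mulgr.
have Knp n x : `|conv (K n) p x| <= Num.sqrt ((d + 1) * << p, p >> * n.+1%:R^-1).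
  rewrite /K haar_convA//.
  apply: le_trans (conv_bound mu_haar G2 x (br n) (bm_conv mu G2 (bri n) bp)) _.
  rewrite -sqrtrM ?dot_ge0//; apply: ler_wsqrtr; rewrite -mulrA.
  apply: ler_pM => //; rewrite ?dot_ge0//.
  rewrite -[leRHS](bm_integral_cst mu) mulrC; apply: bm_integral_le => [||y].
  - by apply: bmM; exact: bm_conv.
  - exact: bm_cst.
  - by rewrite -expr2.
have pK0 : conv p Kl = fun=> 0.
  apply: (@uniform_cvg_unique _ _ (fun n => conv p (K n))).
    exact: uniform_cvg_conv.
  move=> e' e'0.
  have cpos : 0 <= (d + 1) * << p, p >> by rewrite mulr_ge0 ?dot_ge0//; lra.
  have [M HM] := sqrt_inv_small cpos e'0.
  exists M => n x Mn; rewrite subr0 -(invgK x) conv_sym//.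
  exact: le_trans (Knp n _) (HM n Mn).
have Kp0 : conv Kl p = fun=> 0.
  by apply/funext => x; rewrite -(invgK x) conv_sym// pK0.
(* At the unit the eigenvalue equation reads [0 = l * p 1], against [l != 0] and [1 <= p 1]. *)
have := congr1 (fun h => h 1%g) Kp; rewrite haar_convA// Kp0.
rewrite /haar_conv; under eq_Rintegral do rewrite mulr0.
rewrite (bm_integral_cst mu) => /esym/eqP; rewrite mulf_eq0 (negbTE l0)/= => /eqP p10.
by move: p1; rewrite p10 ler10.
Qed.

End RealDensity.

(** * Complex-valued functions *)

Section ComplexBounded.
Context d (T : measurableType d) (R : realType).
Local Notation C := R[i].
Implicit Types f g : T -> C.
Local Notation bm := (@bounded_measurable d T R).

Definition complex_bounded_measurable f :=
  bm (fun x => complex.Re (f x)) /\ bm (fun x => complex.Im (f x)).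
Local Notation cbm := complex_bounded_measurable.

Lemma complex_ReD (x y : C) : complex.Re (x + y) = complex.Re x + complex.Re y.
Proof. by case: x y => [a b] []. Qed.

Lemma complex_ImD (x y : C) : complex.Im (x + y) = complex.Im x + complex.Im y.
Proof. by case: x y => [a b] []. Qed.

Lemma complex_ReM (x y : C) : complex.Re (x * y) =
  complex.Re x * complex.Re y - complex.Im x * complex.Im y.
Proof. by case: x y => [a b] []. Qed.

Lemma complex_ImM (x y : C) : complex.Im (x * y) =
  complex.Re x * complex.Im y + complex.Im x * complex.Re y.
Proof. by case: x y => [a b] []. Qed.

Lemma complex_ReJ (x : C) : complex.Re (x^*) = complex.Re x.
Proof. by case: x. Qed.

Lemma complex_ImJ (x : C) : complex.Im (x^*) = - complex.Im x.
Proof. by case: x. Qed.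

Lemma cbm_cst (c : C) : cbm (fun=> c).
Proof. by split; exact: bm_cst. Qed.

Lemma cbmD f g : cbm f -> cbm g -> cbm (fun x => f x + g x).
Proof.
move=> [rf jf] [rg jg]; split.
  by under eq_fun do rewrite complex_ReD; exact: bmD.
by under eq_fun do rewrite complex_ImD; exact: bmD.
Qed.

Lemma cbmM f g : cbm f -> cbm g -> cbm (fun x => f x * g x).
Proof.
move=> [rf jf] [rg jg]; split.
  by under eq_fun do rewrite complex_ReM; apply: bmB; exact: bmM.
by under eq_fun do rewrite complex_ImM; apply: bmD; exact: bmM.
Qed.

Lemma cbmZ c f : cbm f -> cbm (fun x => c * f x).
Proof. by move=> bf; apply: cbmM => //; exact: cbm_cst. Qed.

Lemma cbmB f g : cbm f -> cbm g -> cbm (fun x => f x - g x).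
Proof.
move=> bf bg; apply: cbmD => //.
by under eq_fun do rewrite -mulN1r; exact: cbmZ.
Qed.

Lemma cbmJ f : cbm f -> cbm (fun x => (f x)^*).
Proof.
move=> [rf jf]; split; first by under eq_fun do rewrite complex_ReJ.
by under eq_fun do rewrite complex_ImJ; exact: bmN.
Qed.

Lemma cbm_sum (I : Type) (r : seq I) (F : I -> T -> C) :
  (forall i, cbm (F i)) -> cbm (fun x => \sum_(i <- r) F i x).
Proof.
move=> bF; elim: r => [|i r IH].
  by under eq_fun do rewrite big_nil; exact: cbm_cst.
by under eq_fun do rewrite big_cons; exact: cbmD.
Qed.

Lemma cbm_real (f : T -> R) : bm f -> cbm (fun x => Complex (f x) 0).
Proof. by move=> bf; split => //; exact: bm_cst. Qed.

Variable mu : probability T R.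
Local Notation I := (cintegral mu).

Lemma complex_ext (x y : C) : complex.Re x = complex.Re y ->
  complex.Im x = complex.Im y -> x = y.
Proof. by case: x y => [a b] [c e] /= -> ->. Qed.

Lemma eq_cintegral f g : f =1 g -> I f = I g.
Proof. by move=> /funext ->. Qed.

Lemma cintegralD f g : cbm f -> cbm g -> I (fun x => f x + g x) = I f + I g.
Proof.
move=> [rf jf] [rg jg]; apply: complex_ext; rewrite (complex_ReD, complex_ImD) /=.
  by rewrite -bm_integralD//; apply: eq_Rintegral => x _; rewrite complex_ReD.
by rewrite -bm_integralD//; apply: eq_Rintegral => x _; rewrite complex_ImD.
Qed.

Lemma cintegralZ c f : cbm f -> I (fun x => c * f x) = c * I f.
Proof.
move=> [rf jf]; apply: complex_ext; rewrite (complex_ReM, complex_ImM) /=.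
  rewrite -!bm_integralZ// -bm_integralB; [|exact: bmZ..].
  by apply: eq_Rintegral => x _; rewrite complex_ReM.
rewrite -!bm_integralZ// -bm_integralD; [|exact: bmZ..].
by apply: eq_Rintegral => x _; rewrite complex_ImM.
Qed.

Lemma cintegral_sum (J : Type) (r : seq J) (F : J -> T -> C) :
  (forall i, cbm (F i)) ->
  I (fun x => \sum_(i <- r) F i x) = \sum_(i <- r) I (F i).
Proof.
move=> bF; elim: r => [|i r IH].
  rewrite big_nil (_ : (fun x => _) = fun x => 0 * 0); last first.
    by apply/funext => x; rewrite big_nil mul0r.
  by rewrite cintegralZ ?mul0r//; exact: cbm_cst.
rewrite big_cons -IH -cintegralD//; last exact: cbm_sum.
by apply: eq_cintegral => x; rewrite big_cons.
Qed.

Lemma cintegral_cst (c : C) : I (fun=> c) = c.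
Proof. by apply: complex_ext; rewrite /= bm_integral_cst. Qed.

Lemma cintegralJ f : cbm f -> I (fun x => (f x)^*) = (I f)^*.
Proof.
move=> [rf jf]; apply: complex_ext; rewrite (complex_ReJ, complex_ImJ) /=.
  by apply: eq_Rintegral => x _; rewrite complex_ReJ.
rewrite -mulN1r -bm_integralZ//; apply: eq_Rintegral => x _.
by rewrite complex_ImJ mulN1r.
Qed.

Lemma cintegral_preserving (h : T -> T) f : cbm f ->
  (forall g : T -> R, bm g -> \int[mu]_x g (h x) = \int[mu]_x g x) ->
  I (fun x => f (h x)) = I f.
Proof.
move=> [rf jf] H; apply: complex_ext => /=.
  exact: (H (fun x => complex.Re (f x))).
exact: (H (fun x => complex.Im (f x))).
Qed.

End ComplexBounded.
Arguments cbm_cst {d T R}.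

(** * Haar integrals of complex functions *)

Section ComplexHaar.
Variables (R : realType) (G : topologicalGroupType).
Local Notation C := R[i].
Variables (mu : probability (borel G) R) (mu_haar : normalized_haar mu).
Hypothesis G2 : @second_countable G.
Hypothesis Gc : compact [set: G].
Local Notation cbm := (@complex_bounded_measurable _ (borel G) R).

Lemma cintegral_mull (g : G) f : cbm f ->
  cintegral mu (fun x => f (g * (x : G))%g) = cintegral mu f.
Proof.
move=> bf; apply: (cintegral_preserving (h := fun x : borel G => (g * (x : G))%g)) => //.
by move=> h; exact: (haar_mull mu_haar).
Qed.

Lemma cintegral_inv f : cbm f ->
  cintegral mu (fun x => f (x : G)^-1%g) = cintegral mu f.
Proof.
move=> bf; apply: (cintegral_preserving (h := fun x : borel G => (x : G)^-1%g)) => //.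
by move=> h; exact: (haar_invg mu_haar).
Qed.

Lemma Im_Re (z : C) : complex.Im z = complex.Re (z * Complex 0 (- 1)).
Proof. by case: z => a b; rewrite complex_ReM /=; ring. Qed.

Lemma continuous_Re (f : G -> C^o) : continuous f ->
  continuous (fun x => complex.Re (f x)).
Proof.
move=> cf x; apply/cvgrPdist_lt => e e0.
have e0' : 0 < (e%:C)%C :> C by rewrite ltcR.
have /cvgrPdist_lt /(_ _ e0') := cf x; apply: filterS => y H.
rewrite -ltcR; apply: le_lt_trans H.
apply: le_trans (normc_ge_Re _).
by rewrite complex_ReD; case: (f y).
Qed.

Lemma cbm_continuous (f : G -> C^o) : continuous f -> cbm f.
Proof.
move=> cf; split; first exact/bm_continuous/continuous_Re.
under eq_fun do rewrite Im_Re.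
apply: bm_continuous => //.
apply: (@continuous_Re (fun x => f x * Complex 0 (- 1))) => x.
by apply: cvgM; [exact: cf|exact: cvg_cst].
Qed.

End ComplexHaar.

(** * Unitary representations *)

Section LinearlyClosed.
Context {T : Type} {C : nzRingType}.

(** A subspace given as a predicate; it is the induction invariant both for linear spans and for
    properties of matrix entries. *)
Definition linearly_closed (S : set (T -> C)) :=
  [/\ S (fun=> 0), forall f g, S f -> S g -> S (fun x => f x + g x)
    & forall c f, S f -> S (fun x => c * f x)].

Lemma linearly_closed_sum S (I : Type) (r : seq I) (F : I -> T -> C) :
  linearly_closed S -> (forall i, S (F i)) -> S (fun x => \sum_(i <- r) F i x).
Proof.
move=> [S0 SD SZ] SF; elim: r => [|i r IH].
  by under eq_fun => x do rewrite big_nil.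
by under eq_fun do rewrite big_cons; exact: SD.
Qed.

Lemma linearly_closed_mull S m n p (A : 'M[C]_(m, n)) (M : T -> 'M[C]_(n, p)) :
  linearly_closed S -> (forall i j, S (fun x => M x i j)) ->
  forall i j, S (fun x => (A *m M x) i j).
Proof.
move=> lS SM i j; have [S0 SD SZ] := lS.
under eq_fun do rewrite mxE.
by apply: linearly_closed_sum => // k; exact: SZ.
Qed.

End LinearlyClosed.

Lemma linearly_closed_mulr {T : Type} {C : comNzRingType} (S : set (T -> C))
    m n p (M : T -> 'M[C]_(m, n)) (A : 'M[C]_(n, p)) :
  linearly_closed S -> (forall i j, S (fun x => M x i j)) ->
  forall i j, S (fun x => (M x *m A) i j).
Proof.
move=> lS SM i j; have [S0 SD SZ] := lS.
under eq_fun => x.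
  rewrite mxE; under eq_bigr do rewrite mulrC.
  over.
by apply: linearly_closed_sum => // k; exact: SZ.
Qed.

Lemma lin_span_closed d (T : measurableType d) (R : realType) (B : set (T -> R[i])) :
  linearly_closed (lin_span B).
Proof.
split.
- exists 0%N, (fun=> 0), (fun _ _ => 0); split; first by case.
  by apply/funext => x; rewrite big_ord0.
- move=> _ _ [n [c [b [Bb ->]]]] [m [e [h [Bh ->]]]].
  exists (n + m)%N, (fun k => match fintype.split k with inl i => c i | inr j => e j end),
    (fun k => match fintype.split k with inl i => b i | inr j => h j end); split.
    by move=> k; case: fintype.split.
  apply/funext => x; rewrite big_split_ord /=.
  congr (_ + _); apply: eq_bigr => i _.
    by rewrite (unsplitK (inl i)).
  by rewrite (unsplitK (inr i)).
- move=> a _ [n [c [b [Bb ->]]]]; exists n, (fun k => a * c k), b; split => //.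
  by apply/funext => x; rewrite mulr_sumr; apply: eq_bigr => k _; rewrite mulrA.
Qed.

Lemma lin_span_mem d (T : measurableType d) (R : realType) (B : set (T -> R[i])) f :
  B f -> lin_span B f.
Proof.
move=> Bf; exists 1%N, (fun=> 1), (fun=> f); split=> //.
by apply/funext => x; rewrite big_ord1 mul1r.
Qed.

Lemma lin_span_ind d (T : measurableType d) (R : realType) (B S : set (T -> R[i])) :
  linearly_closed S -> B `<=` S -> lin_span B `<=` S.
Proof.
move=> lS BS _ [n [c [b [Bb ->]]]]; have [_ _ SZ] := lS.
by apply: linearly_closed_sum => // k; apply/SZ/BS.
Qed.

(** * Subrepresentations and complete reducibility *)

Section UnitaryRepresentations.
Variables (R : realType) (G : topologicalGroupType).
Local Notation C := R[i].
Implicit Types pi rho : unitary_rep R G.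

Lemma continuous_linearly_closed :
  linearly_closed [set f : G -> C | continuous (f : G -> C^o)].
Proof.
split=> [x|f g cf cg x|c f cf x] /=.
- exact: cvg_cst.
- by apply: cvgD; [exact: cf|exact: cg].
- by apply: (cvgM (f := fun=> c : C^o)); [exact: cvg_cst|exact: cf].
Qed.

Lemma rep_mx1 pi : pi 1%g = 1%:M.
Proof.
have U := unitarymx_unit (rep_mx_unitary pi 1%g).
by rewrite -[LHS](mulmxK U) -rep_mxM mul1g mulmxV.
Qed.

Lemma rep_mxV pi x : pi x^-1%g = (pi x)^t*.
Proof.
have U := unitarymx_unit (rep_mx_unitary pi x).
rewrite -(invmx_unitary (rep_mx_unitary pi x)) -[LHS](mulmxK U).
by rewrite -rep_mxM mulVg rep_mx1 mul1mx.
Qed.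

Section SubRepresentation.
Variables (pi : unitary_rep R G) (a : nat) (S : 'M[C]_(a, rep_dim pi)).
Hypotheses (uS : S \is unitarymx) (sS : forall x, (S *m (pi x)^T <= S)%MS).

(** Row spaces are acted on from the right, so [comp x] is the transpose of the compression of
    [pi x]; the rows of [S] form an orthonormal basis of the invariant subspace. *)
Let comp x := S *m (pi x)^T *m S^t*.

Lemma subrep_stable x : comp x *m S = S *m (pi x)^T.
Proof.
have /submxP[w wS] := sS x.
by rewrite /comp wS -(mulmxA w) (unitarymxP uS) mulmx1.
Qed.

Lemma subrep_mxM x y : (comp (x * y)%g)^T = (comp x)^T *m (comp y)^T.
Proof.
rewrite -trmx_mul; congr (_^T).
rewrite {2}/comp !mulmxA subrep_stable /comp rep_mxM trmx_mul.
by rewrite !mulmxA.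
Qed.

Lemma subrep_mx_unitary x : (comp x)^T \is unitarymx.
Proof.
rewrite trmx_unitary; apply/unitarymxP.
have -> : (comp x)^t* = S *m (pi x)^T^t* *m S^t*.
  by rewrite /comp !trmx_mul !map_mxM !mulmxA trmxCK.
rewrite !mulmxA subrep_stable.
have /unitarymxP : (pi x)^T \is unitarymx by rewrite trmx_unitary rep_mx_unitary.
by move=> H; rewrite -(mulmxA S) H mulmx1 (unitarymxP uS).
Qed.

Lemma subrep_mx_continuous i j : continuous (fun x => (comp x)^T i j : C^o).
Proof.
under eq_fun do rewrite mxE.
apply: (linearly_closed_mulr (S := [set f : G -> C | continuous (f : G -> C^o)])).
  exact: continuous_linearly_closed.
apply: (linearly_closed_mull (S := [set f : G -> C | continuous (f : G -> C^o)])).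
  exact: continuous_linearly_closed.
by move=> k l /=; under eq_fun do rewrite mxE; exact: rep_mx_continuous.
Qed.

Definition subrep := UnitaryRep subrep_mxM subrep_mx_unitary subrep_mx_continuous.

Lemma subrep_mxE x : S *m (pi x)^T = (subrep x)^T *m S.
Proof. by rewrite /= trmxK subrep_stable. Qed.

End SubRepresentation.

Local Notation "B ^!" :=
  (orthomx Num.conj (mx_of_hermitian (hermitian1mx _)) B) : matrix_set_scope.

(** Passes from the subspaces of column vectors that define irreducibility to row spaces, where
    ranks, Gram-Schmidt and orthogonal complements are at hand. *)
Lemma reducible_rowspace pi : (0 < rep_dim pi)%N -> ~ irreducible_rep pi ->
  exists k (X : 'M[C]_(k, rep_dim pi)), [/\ forall x, (X *m (pi x)^T <= X)%MS,
    (0 < \rank X)%N & (\rank X < rep_dim pi)%N].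
Proof.
move=> n0 Nirr.
have [V [VG V0 V1]] : exists V : {vspace 'cV[C]_(rep_dim pi)},
    [/\ forall x v, v \in V -> pi x *m v \in V, V <> 0%VS & V <> fullv].
  apply: contrapT => /forallNP H; apply: Nirr; split => // V VG.
  apply: contrapT => /not_orP[? ?]; exact: (H V).
pose X : 'M[C]_(\dim V, rep_dim pi) := \matrix_(i, j) ((vbasis V)`_i) j 0.
have XE (u : 'rV_(rep_dim pi)) : (u <= X)%MS = (u^T \in V).
  have comb (w : 'rV_(\dim V)) : (w *m X)^T = \sum_i w 0 i *: (vbasis V)`_i.
    apply/colP => j; rewrite !mxE summxE; apply: eq_bigr => i _.
    by rewrite !mxE.
  apply/submxP/idP => [[w ->]|uV].
    rewrite comb; apply: memv_suml => i _; apply/memvZ/vbasis_mem.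
    by rewrite mem_nth// size_tuple.
  exists (\row_i coord (vbasis V) i u^T); apply: (can_inj (@trmxK _ _ _)).
  by rewrite comb {1}(coord_vbasis uV); apply: eq_bigr => i _; rewrite mxE.
exists (\dim V), X; split.
- move=> x; apply/row_subP => i; rewrite row_mul XE trmx_mul trmxK.
  by apply: VG; rewrite -XE row_sub.
- rewrite lt0n mxrank_eq0; apply/eqP => X0; apply: V0.
  apply/eqP; rewrite -subv0; apply/subvP => v vV.
  have : (v^T <= X)%MS by rewrite XE trmxK.
  rewrite X0 => /submx0null/(congr1 trmx); rewrite trmxK trmx0 => ->.
  exact: mem0v.
- rewrite ltn_neqAle rank_leq_col andbT; apply/eqP => Xn; apply: V1.
  apply/eqP; rewrite eqEsubv subvf; apply/subvP => v _.
  by rewrite -[v]trmxK -XE submx_full// /row_full Xn.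
Qed.

(** Strong induction on the dimension: a reducible representation splits along an invariant subspace
    and its complement, and its entries are fixed linear combinations of the entries of the two
    pieces. *)
Lemma irreducible_rep_ind (S : set (G -> C)) : linearly_closed S ->
  (forall pi, irreducible_rep pi -> forall i j, S (fun x => pi x i j)) ->
  forall pi i j, S (fun x => pi x i j).
Proof.
move=> lS Sirr pi; have [n] := ubnP (rep_dim pi).
elim: n pi => // n IH pi /ltnSE pin.
have [irr|Nirr] := pselect (irreducible_rep pi); first exact: Sirr.
have [n0|] := posnP (rep_dim pi).
  by move=> i; exfalso; case: i => m; rewrite n0.
move=> /reducible_rowspace /(_ Nirr) [k [X [Xst X0 Xn]]].
pose S1 := schmidt (row_base X); pose S2 := schmidt (row_base X^!%MS).
have S1X : (S1 :=: X)%MS.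
  by apply: eqmx_trans (eq_row_base X); apply: eqmx_schmidt_free; exact: row_base_free.
have S2X : (S2 :=: X^!)%MS.
  by apply: eqmx_trans (eq_row_base _); apply: eqmx_schmidt_free; exact: row_base_free.
have u1 : S1 \is unitarymx by apply: schmidt_unitarymx; exact: rank_leq_col.
have u2 : S2 \is unitarymx by apply: schmidt_unitarymx; exact: rank_leq_col.
have st1 x : (S1 *m (pi x)^T <= S1)%MS.
  by rewrite S1X (submx_trans _ (Xst x))// submxMr// S1X.
(* The complement is stable because the adjoint of [pi x] is [pi x^-1], which preserves [X]. *)
have st2 x : (S2 *m (pi x)^T <= S2)%MS.
  rewrite S2X; apply/orthomx1P; have /submxP[w wX] := Xst x^-1%g.
  have -> : S2 *m (pi x)^T *m X^t* = S2 *m (X *m (pi x^-1%g)^T)^t*.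
    by rewrite trmx_mul map_mxM mulmxA rep_mxV -map_trmx -!map_trmx !trmxK map_mxCK.
  rewrite wX trmx_mul map_mxM mulmxA.
  have /orthomx1P -> : (S2 <= X^!)%MS by rewrite S2X.
  by rewrite mul0mx.
(* The two orthogonal projections add up to the identity. *)
have sum1 : S1^t* *m S1 + S2^t* *m S2 = 1%:M.
  have := mulmxKtV 1%:M (schmidt_complete_unitarymx X) (add_rank_ortho X).
  by rewrite mul1mx /schmidt_complete tr_col_mx map_row_mx mul_row_col.
have d1 : (rep_dim (subrep u1 st1) < n)%N by exact: leq_trans Xn pin.
have d2 : (rep_dim (subrep u2 st2) < n)%N.
  apply: leq_trans pin; rewrite -[ltnRHS](add_rank_ortho X).
  by rewrite -[ltnLHS]add0n ltn_add2r.
move=> i j.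
have E x : pi x i j = (S1^t* *m ((subrep u1 st1 x)^T *m S1)) j i +
    (S2^t* *m ((subrep u2 st2 x)^T *m S2)) j i.
  have -> : pi x i j = (1%:M *m (pi x)^T) j i by rewrite mul1mx mxE.
  by rewrite -sum1 mulmxDl mxE -!mulmxA -!subrep_mxE.
under eq_fun do rewrite E.
have [_ SD _] := lS.
apply: SD; apply: linearly_closed_mull => // k1 l1; apply: linearly_closed_mulr => // k2 l2.
  by under eq_fun do rewrite mxE; exact: IH.
by under eq_fun do rewrite mxE; exact: IH.
Qed.

End UnitaryRepresentations.

(** * Schur's lemma *)

Section SchurLemma.
Variables (R : realType) (G : topologicalGroupType).
Local Notation C := R[i].
Implicit Types pi rho : unitary_rep R G.

Lemma mx_eigenvalue n (M : 'M[C]_n) : (0 < n)%N ->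
  exists a (v : 'cV[C]_n), v != 0 /\ M *m v = a *: v.
Proof.
move=> n0.
have /closed_rootP[a] : size (char_poly M^T) != 1%N.
  by rewrite size_char_poly; case: n n0 M.
rewrite -eigenvalue_root_char => /eigenvalueP[v vM v0].
exists a, v^T; split; first by rewrite -trmx0 (inj_eq trmx_inj).
by rewrite -[M]trmxK -trmx_mul vM linearZ.
Qed.

(** An eigenspace of [M] is nonzero and invariant, hence the whole space. *)
Lemma commutant_scalar pi (M : 'M[C]_(rep_dim pi)) : irreducible_rep pi ->
  (forall x, pi x *m M = M *m pi x) -> exists a, M = a%:M.
Proof.
move=> [n0 irr] comm; have [a [v [v0 Mv]]] := mx_eigenvalue M n0; exists a.
pose V := lker (linfun (mulmx (M - a%:M) : 'cV[C]_(rep_dim pi) -> _)).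
have VE u : (u \in V) = (M *m u == a *: u).
  by rewrite memv_ker lfunE /= mulmxBl mul_scalar_mx subr_eq0.
have [|V0|V1] := irr V.
- move=> x u; rewrite !VE mulmxA -comm -mulmxA => /eqP ->.
  by rewrite scalemxAr.
- have : v \in V by rewrite VE Mv.
  by rewrite V0 memv0 (negbTE v0).
apply/matrixP => i j.
have : (delta_mx j 0 : 'cV[C]__) \in V by rewrite V1 memvf.
rewrite VE => /eqP/matrixP/(_ i 0); rewrite -colE !mxE => ->.
by rewrite eqxx andbT mulr_natr.
Qed.

(** [T *m T^t*] and [T^t* *m T] commute with irreducible representations, so both are scalars; they
    are equal and positive, and dividing [T] by the square root makes it unitary. *)
Lemma intertwiner_equivalent pi rho (T : 'M[C]_(rep_dim rho, rep_dim pi)) :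
  irreducible_rep pi -> irreducible_rep rho ->
  (forall x, T *m pi x = rho x *m T) -> T != 0 -> equivalent_rep pi rho.
Proof.
move=> ipi irho TT T0.
have TT' x : T^t* *m rho x = pi x *m T^t*.
  have := TT x^-1%g => /(congr1 (fun M => M^t*)).
  by rewrite !trmx_mul !map_mxM !rep_mxV !trmxCK.
have [a aE] : exists a, T *m T^t* = a%:M.
  by apply: (commutant_scalar irho) => x; rewrite mulmxA -TT -!mulmxA TT'.
have [b bE] : exists b, T^t* *m T = b%:M.
  by apply: (commutant_scalar ipi) => x; rewrite mulmxA -TT' -!mulmxA TT.
have ab : a = b.
  have : a *: T = b *: T by rewrite -mul_scalar_mx -aE -mulmxA bE mul_mx_scalar.
  move/eqP; rewrite -subr_eq0 -scalerBl scalemx_eq0 (negbTE T0) orbF subr_eq0.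
  by move/eqP.
have /existsP[i /existsP[j Tij]] : [exists i, exists j, T i j != 0].
  apply: contraNT T0; rewrite negb_exists => /forallP H.
  apply/eqP/matrixP => i j; have := H i; rewrite negb_exists => /forallP/(_ j).
  by rewrite negbK mxE => /eqP.
(* [a] is the squared norm of the row [i] of [T], which has a nonzero entry. *)
have a0 : 0 < a.
  have : (T *m T^t*) i i = a by rewrite aE mxE eqxx.
  move=> <-; rewrite mxE (bigD1 j)//= ltr_wpDr//.
    by apply: sumr_ge0 => k _; rewrite !mxE mul_conjC_ge0.
  by rewrite !mxE mul_conjC_gt0.
pose s := sqrtC a.
have s0 : 0 < s by rewrite sqrtC_gt0.
have s2 : s^-1 * s^-1 * a = 1.
  by rewrite -invfM -expr2 sqrtCK mulVf// gt_eqF.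
have sV : (s^-1)^* = s^-1 by apply: geC0_conj; rewrite invr_ge0 ltW.
have sJ m n (M : 'M[C]_(m, n)) : (s^-1 *: M)^t* = s^-1 *: M^t*.
  by apply/matrixP => k l; rewrite !mxE rmorphM /= sV.
exists (s^-1 *: T); split.
- apply/unitarymxP; rewrite sJ -scalemxAl -scalemxAr aE.
  by rewrite scalerA scale_scalar_mx s2.
- rewrite map_trmx sJ; apply/unitarymxP; rewrite sJ trmxCK.
  by rewrite -scalemxAl -scalemxAr bE scalerA scale_scalar_mx -ab s2.
- by move=> x; rewrite -scalemxAl TT scalemxAr.
Qed.

End SchurLemma.

(** * Schur orthogonality relations *)

Section SchurOrthogonality.
Variables (R : realType) (G : topologicalGroupType).
Local Notation C := R[i].
Variables (mu : probability (borel G) R) (mu_haar : normalized_haar mu).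
Hypothesis G2 : @second_countable G.
Hypothesis Gc : compact [set: G].
Local Notation cbm := (@complex_bounded_measurable _ (borel G) R).
Implicit Types pi rho : unitary_rep R G.

Lemma rep_mx_cbm pi i j : cbm (fun x => pi x i j).
Proof. by apply: cbm_continuous => //; exact: rep_mx_continuous. Qed.

Definition mx_integral m n (M : G -> 'M[C]_(m, n)) : 'M[C]_(m, n) :=
  \matrix_(i, j) cintegral mu (fun x : borel G => M x i j).

Lemma mx_integral_mull m n p (A : 'M[C]_(m, n)) (M : G -> 'M[C]_(n, p)) :
  (forall i j, cbm (fun x => M x i j)) ->
  mx_integral (fun x => A *m M x) = A *m mx_integral M.
Proof.
move=> bM; apply/matrixP => i j; rewrite !mxE.
under eq_cintegral do rewrite mxE.
rewrite cintegral_sum => [|k]; last exact: cbmZ.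
by apply: eq_bigr => k _; rewrite cintegralZ// mxE.
Qed.

Lemma mx_integral_mulr m n p (M : G -> 'M[C]_(m, n)) (A : 'M[C]_(n, p)) :
  (forall i j, cbm (fun x => M x i j)) ->
  mx_integral (fun x => M x *m A) = mx_integral M *m A.
Proof.
move=> bM; apply/matrixP => i j; rewrite !mxE.
under eq_cintegral => x.
  rewrite mxE; under eq_bigr do rewrite mulrC.
  over.
rewrite cintegral_sum => [|k]; last exact: cbmZ.
by apply: eq_bigr => k _; rewrite cintegralZ// mxE mulrC.
Qed.

(** Averaging forces any matrix to intertwine [rho] with [pi]; on matrix units its entries are the
    inner products of coefficient functions. *)
Definition intertwining_average pi rho (A : 'M[C]_(rep_dim pi, rep_dim rho)) :=
  mx_integral (fun x => pi x *m A *m (rho x)^t*).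

Lemma average_cbm pi rho (A : 'M[C]_(rep_dim pi, rep_dim rho)) i j :
  cbm (fun x => (pi x *m A *m (rho x)^t*) i j).
Proof.
under eq_fun do rewrite mxE; apply: cbm_sum => k; apply: cbmM.
  under eq_fun do rewrite mxE; apply: cbm_sum => l; apply: cbmM; last exact: cbm_cst.
  exact: rep_mx_cbm.
by under eq_fun do rewrite !mxE; apply: cbmJ; exact: rep_mx_cbm.
Qed.

Lemma intertwining_averageE pi rho (A : 'M[C]_(rep_dim pi, rep_dim rho)) g :
  intertwining_average A *m rho g = pi g *m intertwining_average A.
Proof.
rewrite /intertwining_average -mx_integral_mulr; last exact: average_cbm.
rewrite -mx_integral_mull; last exact: average_cbm.
apply/matrixP => i j; rewrite !mxE.
have H : cbm (fun x => (pi x *m A *m (rho x)^t* *m rho g) i j).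
  under eq_fun do rewrite mxE; apply: cbm_sum => k; apply: cbmM; last exact: cbm_cst.
  exact: average_cbm.
rewrite -(cintegral_mull mu_haar g H); apply: eq_cintegral => x.
rewrite !rep_mxM trmx_mul map_mxM !mulmxA.
have /unitarymxP U : (rho g)^t* \is unitarymx by rewrite trmxC_unitary rep_mx_unitary.
by rewrite trmxCK in U; rewrite -[_ *m rho g]mulmxA U mulmx1.
Qed.

Lemma delta_average pi rho i j a b :
  intertwining_average (delta_mx a b : 'M[C]_(rep_dim pi, rep_dim rho)) i j =
  cintegral mu (fun x => pi x i a * (rho x j b)^*).
Proof.
rewrite mxE; apply: eq_cintegral => x.
rewrite mxE (bigD1 b)//= big1 => [|k kb]; last first.
  rewrite mxE big1 ?mul0r// => l _.
  by rewrite mxE (negbTE kb) andbF mulr0.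
rewrite addr0 !mxE (bigD1 a)//= big1 => [|l la]; last first.
  by rewrite mxE (negbTE la) mulr0.
by rewrite addr0 mxE !eqxx mulr1.
Qed.

Lemma schur_orthogonality_neq pi rho i j a b : irreducible_rep pi ->
  irreducible_rep rho -> ~ equivalent_rep rho pi ->
  cintegral mu (fun x => pi x i a * (rho x j b)^*) = 0.
Proof.
move=> ipi irho Neq; rewrite -delta_average.
set T := intertwining_average _.
have [->|T0] := eqVneq T 0; first by rewrite mxE.
by case: Neq; apply: (intertwiner_equivalent irho ipi _ T0) => x; exact: intertwining_averageE.
Qed.

(** The average of a matrix unit is a scalar matrix. Conjugation by unitary matrices preserves the
    trace, so the scalar is the trace of the unit divided by the dimension. *)
Lemma schur_orthogonality pi i j a b : irreducible_rep pi ->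
  cintegral mu (fun x => pi x i a * (pi x j b)^*) =
  ((i == j) && (a == b))%:R / (rep_dim pi)%:R.
Proof.
move=> ipi; rewrite -delta_average.
set T := intertwining_average _.
have [c cE] : exists c, T = c%:M.
  by apply: (commutant_scalar ipi) => x; rewrite intertwining_averageE.
have d0 : (rep_dim pi)%:R != 0 :> C by rewrite pnatr_eq0 -lt0n; exact: ipi.1.
have : \tr T = (a == b)%:R.
  rewrite /mxtrace.
  under eq_bigr do rewrite delta_average.
  rewrite -cintegral_sum; last first.
    by move=> k; apply: cbmM; [|apply: cbmJ]; exact: rep_mx_cbm.
  rewrite -[RHS](cintegral_cst mu); apply: eq_cintegral => x.
  have /unitarymxP : (pi x)^t* \is unitarymx by rewrite trmxC_unitary rep_mx_unitary.
  rewrite trmxCK => /matrixP/(_ b a); rewrite !mxE eq_sym => <-.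
  by apply: eq_bigr => k _; rewrite !mxE mulrC.
rewrite cE mxtrace_scalar mxE => H.
by rewrite -mulnb natrM -H -[c *+ rep_dim pi]mulr_natr mulrA mulfK// mulr_natl.
Qed.

End SchurOrthogonality.

(** * Coefficient functions and the Cayley operator *)

Section CoefficientFunctions.
Variables (R : realType) (G : topologicalGroupType).
Local Notation C := R[i].
Variables (mu : probability (borel G) R) (mu_haar : normalized_haar mu).
Hypothesis G2 : @second_countable G.
Hypothesis Gc : compact [set: G].
Local Notation cbm := (@complex_bounded_measurable _ (borel G) R).
Implicit Types pi rho : unitary_rep R G.

Lemma rep_coefE pi (i j : 'I_(rep_dim pi)) x : rep_coef i j x = pi x j i.
Proof.
rewrite /rep_coef /cdot -colE (bigD1 j)//= big1 => [|k kj].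
  by rewrite !mxE !eqxx conjC1 mulr1 addr0.
by rewrite !mxE (negbTE kj) conjC0 mulr0.
Qed.

(** The convention for coefficients swaps indices, so [i] selects a column of [pi x]. Left
    translation acts on [z] through the conjugate of [pi], right translation changes the column. *)
Definition coef_comb pi (i : 'I_(rep_dim pi)) (z : 'cV[C]_(rep_dim pi)) (x : G) : C :=
  \sum_j z j 0 * pi x j i.

Lemma coef_comb_cbm pi i z : cbm (@coef_comb pi i z).
Proof. by apply: cbm_sum => j; apply: cbmZ; exact: rep_mx_cbm. Qed.

Lemma coef_comb_translate pi (i : 'I_(rep_dim pi)) z (g x : G) :
  coef_comb i z (x * g)%g = \sum_j (z j 0 * \sum_k pi x j k * pi g k i).
Proof. by apply: eq_bigr => j _; rewrite rep_mxM mxE. Qed.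

Lemma L2dot_coef_comb_expand pi rho i k z w :
  L2dot mu (@coef_comb pi i z) (@coef_comb rho k w) =
  \sum_a \sum_b z a 0 * (w b 0)^* * cintegral mu (fun x => pi x a i * (rho x b k)^*).
Proof.
rewrite /L2dot.
have E x : coef_comb i z x * (coef_comb k w x)^* =
    \sum_a \sum_b z a 0 * (w b 0)^* * (pi x a i * (rho x b k)^*).
  rewrite rmorph_sum mulr_suml; apply: eq_bigr => a _.
  rewrite mulr_sumr; apply: eq_bigr => b _.
  by rewrite rmorphM /=; ring.
have bb a b : cbm (fun x => pi x a i * (rho x b k)^*).
  by apply: cbmM; [|apply: cbmJ]; exact: rep_mx_cbm.
rewrite (eq_cintegral mu E) cintegral_sum => [|a]; last first.
  by apply: cbm_sum => b; exact: cbmZ.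
apply: eq_bigr => a _; rewrite cintegral_sum => [|b]; last exact: cbmZ.
by apply: eq_bigr => b _; rewrite cintegralZ.
Qed.

Lemma L2dot_coef_comb_neq pi rho i k z w : irreducible_rep pi ->
  irreducible_rep rho -> ~ equivalent_rep rho pi ->
  L2dot mu (@coef_comb pi i z) (@coef_comb rho k w) = 0.
Proof.
move=> ipi irho Neq; rewrite L2dot_coef_comb_expand big1// => a _.
by rewrite big1// => b _; rewrite schur_orthogonality_neq ?mulr0.
Qed.

Lemma L2dot_coef_comb pi (i k : 'I_(rep_dim pi)) z w : irreducible_rep pi ->
  L2dot mu (coef_comb i z) (coef_comb k w) =
  (i == k)%:R * cdot z w / (rep_dim pi)%:R.
Proof.
move=> ipi; rewrite L2dot_coef_comb_expand /cdot mulr_sumr mulr_suml.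
apply: eq_bigr => a _; rewrite (bigD1 a)//= big1 => [|b ba].
  by rewrite addr0 schur_orthogonality// eqxx; ring.
by rewrite schur_orthogonality// eq_sym (negbTE ba) mul0r mulr0.
Qed.

(** * The eigenvalue equation *)

Section Graphon.
Variables (gamma : borel G -> R) (gamma_cayley : cayley_function gamma).

Let bgamma : @bounded_measurable _ (borel G) R gamma.
Proof.
have [mg g01 _] := gamma_cayley; split => //; exists 1 => x.
by have /andP[? ?] := g01 x; rewrite ger0_norm.
Qed.

Lemma cayley_operator_coef_comb pi (i : 'I_(rep_dim pi)) z l :
  map_mx Num.conj (rep_integral mu gamma pi) *m z = l *: z ->
  forall x, integral_operator mu (cayley_graphon gamma) (coef_comb i z) x =
    l * coef_comb i z x.
Proof.
move=> zl x; rewrite /integral_operator.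
pose F (y : G) := Complex (gamma y) 0 * coef_comb i z (y^-1 * x)%g.
(* Inversion gives the adjoint of [pi y]; its transpose is absorbed by the pairing with [z], and
   only the entrywise conjugate remains. *)
have EF y : F y = \sum_k \sum_j z j 0 * pi x k i * (Complex (gamma y) 0 * (pi y k j)^*).
  rewrite /F /coef_comb mulr_sumr exchange_big /=; apply: eq_bigr => j _.
  rewrite rep_mxM rep_mxV mxE !mulr_sumr; apply: eq_bigr => k _.
  by rewrite !mxE; ring.
have bJ k j : cbm (fun y => Complex (gamma y) 0 * (pi y k j)^*).
  by apply: cbmM; [exact: cbm_real|apply: cbmJ; exact: rep_mx_cbm].
have bF : cbm F.
  rewrite (_ : F = fun y => \sum_k \sum_j z j 0 * pi x k i * (Complex (gamma y) 0 * (pi y k j)^*)).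
    by apply: cbm_sum => k; apply: cbm_sum => j; exact: cbmZ.
  exact/funext.
(* Left translation by [x] followed by inversion sends [F y] to [F (x * y^-1)], the integrand of the
   operator. *)
transitivity (cintegral mu F).
  rewrite -(cintegral_mull mu_haar x bF).
  have bFx : cbm (fun y => F (x * y)%g).
    have [rF jF] := bF; split.
      exact: (bm_mulgl x rF).
    exact: (bm_mulgl x jF).
  rewrite -(cintegral_inv mu_haar G2 bFx); apply: eq_cintegral => y.
  by rewrite /F /cayley_graphon invgM invgK -mulgA mulVg mulg1.
rewrite (eq_cintegral mu EF) cintegral_sum => [|k]; last first.
  by apply: cbm_sum => j; exact: cbmZ.
rewrite /coef_comb mulr_sumr; apply: eq_bigr => k _.
rewrite cintegral_sum => [|j]; last exact: cbmZ.
have /matrixP/(_ k 0) := zl; rewrite !mxE mulrA => <-.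
rewrite mulr_suml; apply: eq_bigr => j _.
rewrite cintegralZ// !mxE -cintegralJ; last first.
  by apply: cbmM; [exact: cbm_real|exact: rep_mx_cbm].
rewrite mulrC -mulrA mulrCA [in RHS]mulrC -[in RHS]mulrA; congr (_ * _).
rewrite [RHS]mulrC; congr (_ * _).
apply: eq_cintegral => y; rewrite rmorphM /=; congr (_ * _).
by apply: complex_ext; rewrite ?complex_ReJ ?complex_ImJ /= ?oppr0.
Qed.

End Graphon.

(** * The span of the coefficient functions *)

Variables (Ghat : set (unitary_rep R G)) (Ghat_dual : unitary_dual Ghat).
Variable (E : forall pi : unitary_rep R G, seq 'cV[R[i]]_(rep_dim pi)).
Local Notation B := (coef_eigenfunctions Ghat E).

Lemma coef_eigenfunctionsP f : B f <-> exists pi (i : 'I_(rep_dim pi)) z,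
  [/\ Ghat pi, z \in E pi & f = coef_comb i z].
Proof.
have CE pi (i : 'I_(rep_dim pi)) (z : 'cV[R[i]]_(rep_dim pi)) :
    (fun x : borel G => \sum_j z j 0 * rep_coef i j x) = coef_comb i z.
  by apply/funext => x; apply: eq_bigr => j _; rewrite rep_coefE.
split=> [[pi Gpi [i _ [z Ez <-]]]|[pi [i [z [Gpi Ez ->]]]]].
  by exists pi, i, z; split => //; rewrite CE.
by exists pi => //; exists i => //; exists z => //; rewrite CE.
Qed.

Lemma dual_irreducible pi : Ghat pi -> irreducible_rep pi.
Proof. by have [+ _ _] := Ghat_dual; exact. Qed.

Lemma dual_neq pi rho : Ghat pi -> Ghat rho -> pi <> rho -> ~ equivalent_rep rho pi.
Proof.
by move=> Gpi Grho Neq e; apply: Neq; have [_ _ H] := Ghat_dual; apply/esym/H.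
Qed.

Hypothesis E_basis : forall pi, Ghat pi -> basis_of fullv (E pi).

Lemma dual_entries_lin_span pi i j : Ghat pi -> lin_span B (fun x => pi x j i).
Proof.
move=> Gpi; have /andP[/eqP spanE _] := E_basis Gpi.
have lS := lin_span_closed B; have [_ _ SZ] := lS.
have dE : (delta_mx j 0 : 'cV[R[i]]_(rep_dim pi)) \in <<in_tuple (E pi)>>%VS.
  by rewrite /= spanE memvf.
have H := coord_span dE.
rewrite (_ : (fun x => _) = fun x => \sum_k coord (in_tuple (E pi)) k (delta_mx j 0) *
   coef_comb i (in_tuple (E pi))`_k x).
  apply: linearly_closed_sum => // k; apply: (SZ); apply: lin_span_mem.
  by apply/coef_eigenfunctionsP; exists pi, i, (E pi)`_k; split => //; exact: mem_nth.
apply/funext => x.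
transitivity (coef_comb i (delta_mx j 0) x).
  rewrite /coef_comb (bigD1 j)//= big1 => [|k kj].
    by rewrite mxE !eqxx mul1r addr0.
  by rewrite mxE (negbTE kj) mul0r.
rewrite {1}H /coef_comb.
under [RHS]eq_bigr do rewrite mulr_sumr.
rewrite [RHS]exchange_big; apply: eq_bigr => a _.
rewrite summxE mulr_suml; apply: eq_bigr => k _.
by rewrite mxE mulrA.
Qed.

(** By complete reducibility an irreducible [pi] suffices, and it is unitarily conjugate to a member
    of [Ghat], whose entries are reached by expanding unit vectors in [E]. *)
Lemma entries_lin_span pi i j : lin_span B (fun x => pi x i j).
Proof.
have lS := lin_span_closed B.
move: pi i j; apply: (irreducible_rep_ind lS) => rho irho i j.
have [_ H _] := Ghat_dual; have [pi Gpi [U [/unitarymxP uU _ UE]]] := H rho irho.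
have rhoE x : rho x = U *m pi x *m U^t* by rewrite UE -mulmxA uU mulmx1.
under eq_fun do rewrite rhoE.
apply: linearly_closed_mulr => // a b; apply: linearly_closed_mull => // c e.
exact: dual_entries_lin_span.
Qed.

End CoefficientFunctions.

(** * The coefficient functions as a basis of L2 *)

Section SquareIntegrable.
Context d (T : measurableType d) (R : realType) (mu : probability T R).
Local Notation bm := (@bounded_measurable d T R).
Local Notation C := R[i].
Implicit Types u v : T -> R.

Lemma LfunB2 u v : u \in Lfun mu 2%:E -> v \in Lfun mu 2%:E ->
  (fun x => u x - v x) \in Lfun mu 2%:E.
Proof.
have p1 : (1 <= 2%:E :> \bar R)%E by rewrite lee_fin ler1n.
move=> Lu Lv.
have := (Lfun_addr_closed mu p1).2 u (- v) Lu (Lfun_oppr_closed Lv).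
by [].
Qed.

Lemma bm_Lfun2 u : bm u -> u \in Lfun mu 2%:E.
Proof.
move=> bu; rewrite inE; apply/andP; split; rewrite inE/=; first exact: bu.1.
rewrite /finite_norm unlock; apply: poweR_lty.
have := bm_integrable mu (bmM bu bu) => /integrableP[_].
apply: le_lt_trans; rewrite le_eqVlt; apply/orP; left; apply/eqP.
apply: eq_integral => x _ /=.
by rewrite powR_mulrn// real_normK ?num_real// -expr2 ger0_norm// sqr_ge0.
Qed.

Lemma cbm_L2 (f : T -> C) : complex_bounded_measurable f -> L2 mu f.
Proof. by case=> rf jf; split; exact: bm_Lfun2. Qed.

Lemma L2B (f g : T -> C) : L2 mu f -> L2 mu g -> L2 mu (f \- g)%R.
Proof.
move=> [rf jf] [rg jg]; split.
  rewrite (_ : (fun x => _) = fun x => complex.Re (f x) - complex.Re (g x)).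
    exact: LfunB2.
  by apply/funext => x /=; case: (f x) (g x) => [a b] [].
rewrite (_ : (fun x => _) = fun x => complex.Im (f x) - complex.Im (g x)).
  exact: LfunB2.
by apply/funext => x /=; case: (f x) (g x) => [a b] [].
Qed.

Lemma L2normE (f : T -> C) : L2 mu f -> L2norm mu f =
  (Num.sqrt (\int[mu]_x (complex.Re (f x) ^+ 2) + \int[mu]_x (complex.Im (f x) ^+ 2)))%:E.
Proof.
move=> [/Lfun2_integrable_sqr rf /Lfun2_integrable_sqr jf].
rewrite -RintegralD// /L2norm unlock.
have -> : (\int[mu]_x (`| (Normc.normc (f x))%:E | `^ 2) =
    \int[mu]_x (complex.Re (f x) ^+ 2 + complex.Im (f x) ^+ 2)%:E)%E.
  apply: eq_integral => x _ /=.
  rewrite powR_mulrn// real_normK ?num_real//.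
  by case: (f x) => a b /=; rewrite sqr_sqrtr// addr_ge0// sqr_ge0.
rewrite /Rintegral -[X in (X `^ _)%E]fineK; last first.
  by apply: integrable_fin_num => //; exact: (integrableD measurableT rf jf).
by rewrite poweR_EFin -powR12_sqrt// Rintegral_ge0// => x _; rewrite addr_ge0// sqr_ge0.
Qed.

(** Truncate where [|u|] exceeds [n]; the squared errors are dominated by [u ^+ 2] and vanish
    pointwise for large [n]. *)
Lemma Lfun2_bm_approx u e : u \in Lfun mu 2%:E -> 0 < e ->
  exists2 v, bm v & \int[mu]_x ((u x - v x) ^+ 2) < e.
Proof.
move=> Lu e0.
have mu_ : measurable_fun setT u by have := sub_Lfun_mfun Lu; rewrite inE.
have iu := Lfun2_integrable_sqr Lu.
pose A n := [set x | `|u x| <= n%:R].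
have mA n : measurable (A n).
  rewrite (_ : A n = (fun x => `|u x|) @^-1` `]-oo, n%:R]); last first.
    by apply/seteqP; split=> x /=; rewrite in_itv.
  rewrite -[_ @^-1` _]setTI; apply: (measurableT_comp (@normr_measurable R setT) mu_) => //.
pose v n x := u x * \1_(A n) x.
have bv n : bm (v n).
  split; first by apply: measurable_funM => //; exact: measurable_indic.
  exists n%:R => x; rewrite /v indicE.
  have [Ax|Ax] := pselect (A n x); first by rewrite mem_set// mulr1.
  by rewrite memNset// mulr0 normr0.
have cv : (\int[mu]_x (((u x - v n x) ^+ 2)%:E))%E @[n --> \oo] -->
    (\int[mu]_(x in setT) (0 : \bar R))%E.
  apply: (@dominated_cvg _ _ _ mu setT measurableT _ (cst 0%E) (fun x => (u x ^+ 2)%:E)) => //.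
  - move=> n; apply/measurable_EFinP/measurable_funX/measurable_funB => //.
    exact: (bv n).1.
  - move=> x _; apply: (@cvg_near_cst _ _ _ _ _ eventually_filter).
    exists (Num.bound `|u x|) => // n /= xn; rewrite /v indicE mem_set.
      by rewrite mulr1 subrr expr0n.
    by rewrite /A /=; apply: le_trans (ltW (archi_boundP (normr_ge0 _))) _; rewrite ler_nat.
  - move=> n x _; rewrite abse_EFin lee_fin ger0_norm ?sqr_ge0// /v indicE.
    by case: (_ \in _); rewrite ?mulr1 ?mulr0 ?subrr ?subr0// expr0n sqr_ge0.
rewrite integral0 in cv.
move/fine_cvgP : cv => [_ /cvgrPdist_lt /(_ e e0) [n _ /(_ n (leqnn n))]] /= H.
exists (v n) => //; apply: le_lt_trans H.
by rewrite sub0r normrN ler_norm.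
Qed.

Lemma Rintegral_sqr_triangle u v w : u \in Lfun mu 2%:E -> v \in Lfun mu 2%:E ->
  w \in Lfun mu 2%:E ->
  \int[mu]_x ((u x - w x) ^+ 2) <=
  2 * \int[mu]_x ((u x - v x) ^+ 2) + 2 * \int[mu]_x ((v x - w x) ^+ 2).
Proof.
move=> Lu Lv Lw.
have iuv := Lfun2_integrable_sqr (LfunB2 Lu Lv).
have ivw := Lfun2_integrable_sqr (LfunB2 Lv Lw).
have iuw := Lfun2_integrable_sqr (LfunB2 Lu Lw).
have i2 h : mu.-integrable setT (EFin \o h) -> mu.-integrable setT (EFin \o (fun x => 2 * h x)).
  move=> ih; rewrite (_ : _ \o _ = fun x => (2%:E * (h x)%:E)%E)//.
  exact: (integrableZl measurableT).
rewrite -!RintegralZl// -RintegralD//; [|exact: (i2 _ iuv)|exact: (i2 _ ivw)].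
apply: le_Rintegral => //.
  exact: (integrableD measurableT (i2 _ iuv) (i2 _ ivw)).
move=> x _; have := sqr_ge0 ((u x - v x) - (v x - w x)); rewrite -subr_ge0 => H.
rewrite -subr_ge0 (_ : _ - _ = (u x - v x - (v x - w x)) ^+ 2 ) ?sqr_ge0//; ring.
Qed.

End SquareIntegrable.

(** * Totality and minimality *)

Section Eigenbasis.
Variables (R : realType) (G : topologicalGroupType).
Local Notation C := R[i].
Variables (mu : probability (borel G) R) (mu_haar : normalized_haar mu).
Hypothesis Gh : hausdorff_space G.
Hypothesis Gc : compact [set: G].
Hypothesis G2 : @second_countable G.
Variables (Ghat : set (unitary_rep R G)) (Ghat_dual : unitary_dual Ghat).
Variable (E : forall pi : unitary_rep R G, seq 'cV[R[i]]_(rep_dim pi)).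
Hypothesis E_basis : forall pi, Ghat pi -> basis_of fullv (E pi).
Local Notation B := (coef_eigenfunctions Ghat E).
Local Notation bm := (@bounded_measurable _ (borel G) R).
Local Notation cbm := (@complex_bounded_measurable _ (borel G) R).

Lemma lin_span_cbm f : lin_span B f -> cbm f.
Proof.
apply: (@lin_span_ind _ _ _ _ cbm).
  by split=> [|f1 f2|c f1]; [exact: cbm_cst|exact: cbmD|exact: cbmZ].
by move=> _ /coef_eigenfunctionsP[pi [i [z [_ _ ->]]]]; exact: coef_comb_cbm.
Qed.

(** Right translation multiplies [pi x] on the right by the constant matrix [pi g], so the translate
    is a combination of entries of the same representation. *)
Lemma lin_span_translate (g : G) (f : borel G -> C) : lin_span B f ->
  lin_span B (fun x : borel G => f ((x : G) * g)%g).
Proof.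
have lS := lin_span_closed B; have [S0 SD SZ] := lS.
pose S := [set f : borel G -> C | lin_span B (fun x : borel G => f ((x : G) * g)%g)].
suff : lin_span B `<=` S by apply.
apply: lin_span_ind.
  by split=> [|f1 f2|c f1] /=; [exact: S0|exact: SD|exact: SZ].
move=> _ /coef_eigenfunctionsP[pi [i [z [_ _ ->]]]] /=.
rewrite /S /=.
under eq_fun do rewrite coef_comb_translate.
apply: linearly_closed_sum => // j; apply: (SZ).
rewrite (_ : (fun x => _) = fun x => \sum_k pi g k i * pi x j k); last first.
  by apply/funext => x; apply: eq_bigr => k _; rewrite mulrC.
apply: linearly_closed_sum => // k; apply: SZ.
exact: entries_lin_span.
Qed.

(** The bridge from real to complex: an orthogonal matrix is unitary when read over the complex
    numbers. *)
Lemma orthogonal_entries_lin_span k (rho : G -> 'M[R]_k) i j :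
  (forall x y, rho (x * y)%g = rho x *m rho y) ->
  (forall x, rho x *m (rho x)^T = 1%:M) ->
  (forall i j, continuous (fun x => rho x i j)) ->
  lin_span B (fun x => Complex (rho x i j) 0).
Proof.
move=> rM rO rc.
pose rhoC x : 'M[C]_k := map_mx (real_complex R) (rho x).
have rCM x y : rhoC (x * y)%g = rhoC x *m rhoC y by rewrite /rhoC rM map_mxM.
have rCU x : rhoC x \is unitarymx.
  apply/unitarymxP.
  have -> : map_mx Num.conj (rhoC x)^T = map_mx (real_complex R) (rho x)^T.
    apply/matrixP => a b; rewrite !mxE.
    by apply: complex_ext; rewrite ?complex_ReJ ?complex_ImJ //= oppr0.
  by rewrite -map_mxM rO map_mx1.
have rCc a b : continuous (fun x => rhoC x a b : C^o).
  move=> x; under eq_fun do rewrite mxE.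
  apply/cvgrPdist_lt => e e0 /=.
  have eE : e = ((complex.Re e)%:C)%C by rewrite RRe_real// gtr0_real.
  have e0' : 0 < complex.Re e by move: e0; rewrite {1}eE ltcR.
  have /cvgrPdist_lt /(_ _ e0') := rc a b x; apply: filterS => y.
  by rewrite /= -rmorphB /= eE normc_def /= expr0n addr0 sqrtr_sqr ltcR.
have := entries_lin_span Ghat_dual E_basis (pi := UnitaryRep rCM rCU rCc) i j.
by congr lin_span; apply/funext => x; rewrite /= mxE.
Qed.

Lemma real_lin_span_dense f e : bm f -> 0 < e ->
  exists2 m, bm m /\ lin_span B (fun x => Complex (m x) 0) &
    dot mu (fun x => f x - m x) (fun x => f x - m x) < e.
Proof.
have [S0 SD SZ] := lin_span_closed B.
move=> bf e0.
have ND (m1 m2 : G -> R) : lin_span B (fun x => Complex (m1 x) 0) ->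
    lin_span B (fun x => Complex (m2 x) 0) -> lin_span B (fun x => Complex (m1 x + m2 x) 0).
  move=> /SD /[apply]; congr lin_span; apply/funext => x.
  by apply: complex_ext; rewrite ?complex_ReD ?complex_ImD /= ?addr0.
have NZ c (m : G -> R) : lin_span B (fun x => Complex (m x) 0) ->
    lin_span B (fun x => Complex (c * m x) 0).
  move=> /(SZ (Complex c 0)); congr lin_span; apply/funext => x.
  by apply: complex_ext; rewrite ?complex_ReM ?complex_ImM /= ?mul0r ?mulr0 ?subr0 ?addr0.
have [m Nm me] := @real_density R G mu mu_haar G2 Gh Gc
  [set m | lin_span B (fun x => Complex (m x) 0)]
  (fun m Nm => (lin_span_cbm Nm).1) S0 ND NZ
  (fun g f Nf => lin_span_translate g Nf)
  (fun k rho rM rO rc i j => orthogonal_entries_lin_span i j rM rO rc) f e bf e0.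
by exists m => //; split => //; exact: (lin_span_cbm Nm).1.
Qed.

Lemma L2_lin_span_dense f : L2 mu f -> L2_closed_span mu B f.
Proof.
have [S0 SD SZ] := lin_span_closed B.
move=> Lf; split => // e e0; have [rf jf] := Lf.
(* Truncation and density each cost [e ^+ 2 / 8]; the factors 2 in the squared triangle inequality
   give [e ^+ 2 / 2] for the real part and as much for the imaginary part. *)
have e2 : 0 < e ^+ 2 / 8 by rewrite divr_gt0 ?exprn_gt0.
have approx u : u \in Lfun mu 2%:E -> exists2 m, bm m /\ lin_span B (fun x => Complex (m x) 0) &
    \int[mu]_x ((u x - m x) ^+ 2) < e ^+ 2 / 2.
  move=> Lu; have [v bv uv] := Lfun2_bm_approx Lu e2.
  have [m [bm_m Nm] vm] := real_lin_span_dense bv e2; exists m => //.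
  apply: le_lt_trans (Rintegral_sqr_triangle Lu (bm_Lfun2 mu bv) (bm_Lfun2 mu bm_m)) _.
  by move: uv vm; rewrite /dot; lra.
have [m [bm_m Nm] um] := approx _ rf; have [k [bm_k Nk] uk] := approx _ jf.
pose g x := Complex (m x) 0 + Complex 0 1 * Complex (k x) 0.
have Ng : lin_span B g by apply: SD => //; exact: SZ.
exists g => //; rewrite L2normE ?lte_fin; last first.
  by apply: L2B => //; apply: cbm_L2; exact: lin_span_cbm.
rewrite -[ltRHS](ger0_norm (ltW e0)) -sqrtr_sqr ltr_sqrt ?exprn_gt0//.
under eq_Rintegral => x _.
  rewrite /= complex_ReD (_ : complex.Re (- g x) = - m x); last first.
    by rewrite /g /=; ring.
  over.
under [X in _ + X < _]eq_Rintegral => x _.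
  rewrite /= complex_ImD (_ : complex.Im (- g x) = - k x); last first.
    by rewrite /g /=; ring.
  over.
lra.
Qed.

Lemma L2dot_lin_span0 (S : set (borel G -> C)) h : S `<=` B -> cbm h ->
  (forall b, S b -> L2dot mu b h = 0) -> forall g, lin_span S g -> L2dot mu g h = 0.
Proof.
move=> SB bh Sh.
suff H : lin_span S `<=` [set g | cbm g /\ L2dot mu g h = 0] by move=> g /H[].
have bJ := cbmJ bh.
apply: lin_span_ind => [|b Sb]; last first.
  by split; [exact/lin_span_cbm/lin_span_mem/SB|exact: Sh].
split=> [|f1 f2 [b1 d1] [b2 d2]|c f1 [b1 d1]].
- split; first exact: cbm_cst.
  rewrite /L2dot; under eq_cintegral do rewrite mul0r.
  exact: cintegral_cst.
- split; first exact: cbmD.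
  rewrite /L2dot; under eq_cintegral do rewrite mulrDl.
  by rewrite cintegralD; [rewrite -!/(L2dot _ _ _) d1 d2 addr0|exact: cbmM..].
- split; first exact: cbmZ.
  rewrite /L2dot; under eq_cintegral do rewrite -mulrA.
  by rewrite cintegralZ; [rewrite -/(L2dot _ _ _) d1 mulr0|exact: cbmM].
Qed.

(** Cauchy-Schwarz is applied to real and imaginary parts separately, hence the sum of two norms;
    any constant depending only on [h] will do. *)
Lemma Re_L2dot_le f h e : cbm f -> cbm h -> (L2norm mu f < e%:E)%E ->
  complex.Re (L2dot mu f h) <= e *
    (Num.sqrt (dot mu (fun x => complex.Re (h x)) (fun x => complex.Re (h x))) +
     Num.sqrt (dot mu (fun x => complex.Im (h x)) (fun x => complex.Im (h x)))).
Proof.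
move=> [rf jf] [rh jh]; rewrite L2normE ?lte_fin; last exact: cbm_L2.
set q1 := (\int[mu]_x _); set q2 := (\int[mu]_x _) => He.
have q10 : 0 <= q1 by apply: Rintegral_ge0 => x _; exact: sqr_ge0.
have q20 : 0 <= q2 by apply: Rintegral_ge0 => x _; exact: sqr_ge0.
have -> : complex.Re (L2dot mu f h) =
    dot mu (fun x => complex.Re (f x)) (fun x => complex.Re (h x)) +
    dot mu (fun x => complex.Im (f x)) (fun x => complex.Im (h x)).
  rewrite /L2dot /cintegral /= -bm_integralD; [|exact: bmM..].
  by apply: eq_Rintegral => x _; rewrite complex_ReM complex_ReJ complex_ImJ mulrN opprK.
rewrite mulrDr; apply: lerD.
  apply: le_trans (ler_norm _) _; apply: le_trans (cauchy_schwarz mu rf rh) _.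
  rewrite ler_wpM2r// -/q1; apply: le_trans (ltW He); rewrite ler_wsqrtr//.
  by rewrite /dot; under eq_Rintegral do rewrite -expr2; rewrite -/q1 lerDl.
apply: le_trans (ler_norm _) _; apply: le_trans (cauchy_schwarz mu jf jh) _.
rewrite ler_wpM2r//; apply: le_trans (ltW He); rewrite ler_wsqrtr//.
by rewrite /dot; under eq_Rintegral do rewrite -expr2; rewrite -/q2 lerDr.
Qed.

(** Continuity of the inner product. A one-sided bound on the real part suffices, as it will be
    contradicted by a strictly positive pairing. *)
Lemma L2_closed_span_dot (S : set (borel G -> C)) b h : S `<=` B -> cbm b -> cbm h ->
  (forall s, S s -> L2dot mu s h = 0) -> L2_closed_span mu S b ->
  complex.Re (L2dot mu b h) <= 0.
Proof.
move=> SB bb bh Sh [_ clb]; apply/ler_addgt0Pr => e e0; rewrite add0r.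
pose M := Num.sqrt (dot mu (fun x => complex.Re (h x)) (fun x => complex.Re (h x)))
     + Num.sqrt (dot mu (fun x => complex.Im (h x)) (fun x => complex.Im (h x))).
have M0 : 0 < M + 1 by rewrite ltr_wpDl// addr_ge0.
have [g Sg ge] := clb _ (divr_gt0 e0 M0).
have bg : cbm g.
  apply: lin_span_cbm; move: Sg; apply: lin_span_ind; first exact: lin_span_closed.
  by move=> s /SB; exact: lin_span_mem.
have := Re_L2dot_le (cbmB bb bg) bh ge.
have -> : L2dot mu (b \- g)%R h = L2dot mu b h.
  have := L2dot_lin_span0 SB bh Sh Sg; rewrite /L2dot => H.
  rewrite (eq_cintegral mu (g := fun x => b x * (h x)^* + -1 * (g x * (h x)^*))); last first.
    by move=> x /=; rewrite mulrBl mulN1r.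
  have bJ := cbmJ bh.
  rewrite cintegralD ?cintegralZ ?H ?mulr0 ?addr0//; try exact: cbmM.
  by apply: cbmZ; exact: cbmM.
move=> H; apply: le_trans H _; rewrite -/M mulrAC ler_pdivrMr//.
by rewrite ler_wpM2l ?(ltW e0)// lerDl.
Qed.

(** The coordinate functional of [z] in the basis [E pi], represented through [cdot]; the entries
    are conjugated because [cdot] conjugates its second argument. *)
Lemma dual_vector pi z : Ghat pi -> z \in E pi ->
  exists w, cdot z w = 1 /\ forall z', z' \in E pi -> z' != z -> cdot z' w = 0.
Proof.
move=> Gpi Ez; have /andP[/eqP spanE freeE] := E_basis Gpi.
set X := in_tuple (E pi).
have zk : (index z (E pi) < size (E pi))%N by rewrite index_mem.
pose k : 'I_(size (E pi)) := Ordinal zk.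
exists (\col_b (coord X k (delta_mx b 0))^*).
have cE v : cdot v (\col_b (coord X k (delta_mx b 0))^*) = coord X k v.
  rewrite {2}(matrix_sum_delta v) linear_sum /=; apply: eq_bigr => b _.
  by rewrite big_ord1 linearZ /= mxE conjCK.
split.
  have Xk : X`_k = z by exact: nth_index.
  by rewrite cE -[in LHS]Xk coord_free// eqxx.
move=> z' Ez' zz'.
have zk' : (index z' (E pi) < size (E pi))%N by rewrite index_mem.
have Xk' : X`_(Ordinal zk') = z' by exact: nth_index.
rewrite cE -[in LHS]Xk' coord_free// -val_eqE /=.
case: eqP => // H; move: zz'.
by rewrite -(nth_index 0 Ez) -(nth_index 0 Ez') H eqxx.
Qed.

(** Schur orthogonality disposes of other classes and other columns; within one class and column the
    pairing reduces to the dual vector. *)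
Lemma dual_function b : B b -> exists h, [/\ cbm h, 0 < complex.Re (L2dot mu b h)
  & forall b', B b' -> b' <> b -> L2dot mu b' h = 0].
Proof.
move=> /coef_eigenfunctionsP[pi [i [z [Gpi Ez ->]]]].
have ipi := dual_irreducible Ghat_dual Gpi.
have [w [zw w0]] := dual_vector Gpi Ez.
exists (coef_comb i w); split; first exact: coef_comb_cbm.
  rewrite L2dot_coef_comb// eqxx mul1r zw div1r.
  have : 0 < (rep_dim pi)%:R^-1 :> C by rewrite invr_gt0 ltr0n; exact: ipi.1.
  by rewrite ltcE => /andP[].
move=> _ /coef_eigenfunctionsP[rho [k [z' [Grho Ez' ->]]]] Neq.
have [rp|] := pselect (rho = pi); last first.
  move=> H; apply: L2dot_coef_comb_neq => //; first exact: dual_irreducible Grho.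
  by apply: dual_neq Ghat_dual _ _ _ _ _.
subst rho; rewrite L2dot_coef_comb//.
have [ki|ki] := eqVneq k i; last by rewrite !mul0r.
rewrite w0 ?mulr0 ?mul0r//; apply/eqP => zz'.
by apply: Neq; rewrite ki zz'.
Qed.

Lemma ae_zero_L2dot f h : cbm f -> cbm h -> {ae mu, forall x, f x = 0} ->
  complex.Re (L2dot mu f h) = 0.
Proof.
move=> bf bh f0; have [bfh _] := cbmM bf (cbmJ bh).
rewrite /L2dot /cintegral /= /Rintegral.
rewrite (ae_eq_integral (cst 0%E)) ?integral0//.
- by apply/measurable_EFinP; exact: bfh.1.
- by apply: filterS f0 => x fx0 _; rewrite fx0 mul0r.
Qed.

Lemma hilbert_basis_coef_eigenfunctions : hilbert_basis mu B.
Proof.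
split=> [b Bb|f|b Bb clb].
- exact/cbm_L2/lin_span_cbm/lin_span_mem.
- exact: L2_lin_span_dense.
have [h [bh bh0 b'h]] := dual_function Bb.
move: bh0; rewrite ltNge => /negP; apply.
apply: (L2_closed_span_dot (S := B `\ b) _ _ bh _ clb).
- by move=> s [].
- exact/lin_span_cbm/lin_span_mem.
- by move=> s [Bs sb]; apply: b'h.
Qed.

End Eigenbasis.

(** Within one class and one index, the inner product of two functions is a positive multiple of
    [cdot]. Orthogonality of the functions therefore comes from that of each [E pi], which is why it
    is stated as a separate conclusion. *)
Theorem proposition4p7 (R : realType) (G : topologicalGroupType)
  (G_hausdorff : hausdorff_space G)
  (G_compact : compact [set: G])
  (G_second_countable : @second_countable G)
  (mu : probability (borel G) R) (mu_haar : normalized_haar mu)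
  (gamma : borel G -> R) (gamma_cayley : cayley_function gamma)
  (Ghat : set (unitary_rep R G)) (Ghat_dual : unitary_dual Ghat)
  (E : forall pi : unitary_rep R G, seq 'cV[R[i]]_(rep_dim pi))
  (E_eigenbasis : forall pi, Ghat pi ->
     mx_eigenbasis (map_mx Num.conj (rep_integral mu gamma pi)) (E pi)) :
  L2_eigenbasis mu (integral_operator mu (cayley_graphon gamma))
    (coef_eigenfunctions Ghat E) /\
  ((forall pi, Ghat pi -> mx_orthogonal (E pi)) ->
   L2_orthogonal_eigenbasis mu (integral_operator mu (cayley_graphon gamma))
     (coef_eigenfunctions Ghat E)).
Proof.
have E_basis pi : Ghat pi -> basis_of fullv (E pi) by move=> /E_eigenbasis[].
have basis : L2_eigenbasis mu (integral_operator mu (cayley_graphon gamma))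
    (coef_eigenfunctions Ghat E).
  split; first exact: hilbert_basis_coef_eigenfunctions.
  move=> f Bf; have bf := lin_span_cbm G_compact (lin_span_mem Bf).
  split; first exact: cbm_L2.
    (* A function with nonzero pairing against its dual cannot vanish almost everywhere. *)
    have [h [bh fh _]] := dual_function mu_haar G_compact Ghat_dual E_basis Bf.
    by move=> /(ae_zero_L2dot bf bh) f0; rewrite f0 ltxx in fh.
  have [pi [i [z [Gpi Ez fE]]]] := (coef_eigenfunctionsP Ghat E f).1 Bf.
  have [_ [l zl]] := (E_eigenbasis _ Gpi).2 _ Ez.
  exists l; apply: (@filterS _ _ _ setT); last exact: filterT.
  by move=> x _; rewrite fE; exact: cayley_operator_coef_comb zl x.
split => // orthE; split => // f g.
move=> /coef_eigenfunctionsP[pi [i [z [Gpi Ez ->]]]].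
move=> /coef_eigenfunctionsP[rho [k [w [Grho Ew ->]]]] Neq.
have [rp|Nrp] := pselect (rho = pi); last first.
  have ipi := dual_irreducible Ghat_dual Gpi.
  have irho := dual_irreducible Ghat_dual Grho.
  apply: L2dot_coef_comb_neq => //.
  by apply: (dual_neq Ghat_dual Gpi Grho) => /esym.
subst rho; rewrite L2dot_coef_comb//; last exact: (dual_irreducible Ghat_dual Gpi).
have [ik|_] := eqVneq i k; last by rewrite !mul0r.
rewrite (orthE _ Gpi z w Ez Ew) ?mulr0 ?mul0r//.
by apply/eqP => zw; apply: Neq; rewrite ik zw.
Qed.
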